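(* Let $g_1,\ldots,g_q$ be homogeneous polynomials of even degree on $\mathbb{R}^n$, let $\mathcal{K} = \{ x \in \mathbb{R}^n: g_1(x)\geq 0, \ldots, g_q(x) \geq 0 \}$, and suppose that $\mathcal{K} \setminus\{0\}$ is nonempty. Let $P(x)$ be an $m\times m$ homogeneous polynomial matrix of even degree whose sparsity graph is chordal and has maximal cliques $\mathcal{C}_1,\ldots,\mathcal{C}_t$. If $P$ is strictly positive definite on $\mathcal{K} \setminus\{0\}$, then there exist an integer $\nu \geq 0$ and homogeneous SOS matrices $S_{j,k}(x)$ of size $|\mathcal{C}_k| \times |\mathcal{C}_k|$, $j=0,\ldots,q$, $k=1,\ldots,t$, such that $$\|x\|^{2\nu} P(x) = \sum_{k=1}^t E_{\mathcal{C}_k}^{\mathsf T} \Big( S_{0,k}(x) + \sum_{j=1}^q g_j(x)S_{j,k}(x) \Big) E_{\mathcal{C}_k}.$$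
   Context: Polynomials have real coefficients and variables $x=(x_1,\ldots,x_n)$; $\|x\|^2=x_1^2+\cdots+x_n^2$. An $m\times m$ polynomial matrix $P$ is a symmetric matrix with polynomial entries; it is homogeneous if all its entries are homogeneous of the same degree (the zero polynomial counts as homogeneous of every degree). Its sparsity graph is the undirected graph with vertices $\{1,\ldots,m\}$ and edge set $\mathcal{E}$ such that, for $i\ne j$, $(i,j)\notin\mathcal{E}$ if and only if $P_{ij}\equiv 0$. A clique is a set of vertices that are pairwise connected by edges; it is maximal if not contained in any other clique. A graph is chordal if every cycle of length at least $4$ has a chord (an edge joining two nonconsecutive vertices of the cycle). For a clique $\mathcal{C}$, with elements listed as $\mathcal{C}(1),\ldots,\mathcal{C}(|\mathcal{C}|)$ in increasing order, $E_{\mathcal{C}}\in\mathbb{R}^{|\mathcal{C}|\times m}$ is the matrix with $(E_{\mathcal{C}})_{ij}=1$ if $\mathcal{C}(i)=j$ and $0$ otherwise. A polynomial matrix $S(x)$ is SOS if $S(x)=H(x)^{\mathsf T}H(x)$ for some (possibly rectangular) polynomial matrix $H(x)$. *)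

(* Defs.v *)
(* all_analysis can be imported alongside mpoly only if mpoly comes first. *)
From mathcomp Require Import all_boot all_order all_algebra.
From mathcomp Require Import mpoly.
From mathcomp Require Import reals.

Set Implicit Arguments.
Unset Strict Implicit.
Unset Printing Implicit Defensive.

Import Order.TTheory GRing.Theory Num.Theory.

Local Open Scope ring_scope.

Section Graphs.
Variables (T : finType) (e : rel T).

Definition clique (A : {set T}) : bool :=
  [forall x in A, forall y in A, (x != y) ==> e x y].

Definition maximal_clique (A : {set T}) : bool := maxset clique A.

(* The vertices of c are pairwise distinct (ucycle), so next c x and prev c x
   are exactly the two neighbours of x along the cycle. *)
Definition chordal : Prop :=
  forall c : seq T, ucycle e c -> (4 <= size c)%N ->
    exists x y : T,
      [/\ x \in c, y \in c, e x y, y != next c x & y != prev c x].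

End Graphs.

Section PolynomialMatrices.
Variables (R : realType) (n : nat).

Definition sparsity_graph (m : nat) (P : 'M[{mpoly R[n]}]_m) : rel 'I_m :=
  [rel i j | (i != j) && (P i j != 0)].

(* One degree for all entries; 0 is homogeneous of every degree. *)
Definition homog_mx (d m : nat) (P : 'M[{mpoly R[n]}]_m) : Prop :=
  forall i j : 'I_m, P i j \is d.-homog.

Definition sos_mx (m : nat) (S : 'M[{mpoly R[n]}]_m) : Prop :=
  exists (r : nat) (H : 'M[{mpoly R[n]}]_(r, m)), S = H^T *m H.

Definition eval_mx (m : nat) (P : 'M[{mpoly R[n]}]_m) (x : 'rV[R]_n) : 'M[R]_m :=
  \matrix_(i, j) (P i j).@[x 0].

Definition posdef (m : nat) (M : 'M[R]_m) : Prop :=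
  forall v : 'cV[R]_m, v != 0 -> 0 < (v^T *m M *m v) 0 0.

Definition basic_semialg (q : nat) (g : 'I_q -> {mpoly R[n]}) (x : 'rV[R]_n) : Prop :=
  forall j : 'I_q, 0 <= (g j).@[x 0].

Definition sqnorm_mpoly : {mpoly R[n]} := \sum_(i < n) 'X_i ^+ 2.

End PolynomialMatrices.

(* enum_val lists the elements of C in increasing order. *)
Definition clique_mx (A : pzRingType) (m : nat) (C : {set 'I_m}) : 'M[A]_(#|C|, m) :=
  \matrix_(i < #|C|, j < m) (enum_val i == j)%:R.

(* Main.v *)
Require Import Defs.
From mathcomp Require Import all_boot all_order all_algebra.
From mathcomp Require Import mpoly.
From mathcomp Require Import reals.
From mathcomp Require Import ring lra zify.
From mathcomp Require Import boolp classical_sets topology normedtype derive.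

Set Implicit Arguments.
Unset Strict Implicit.
Unset Printing Implicit Defensive.

Import Order.TTheory GRing.Theory Num.Theory.
Import numFieldNormedType.Exports.

Local Open Scope ring_scope.

(* A vertex s of a chordal graph whose neighbours form a clique can be split off
   from P: after multiplication by a power of |x|^2, P is the sum of a matrix
   supported on the clique of s and a matrix not involving s, both still positive
   definite on K \ {0}.  The inverse of the pivot needed for this is replaced by a
   truncated geometric series, so that everything stays polynomial.  Iterating
   reduces the theorem to one full block.  There the constraints, scaled so that
   g_j <= 1 on the unit sphere, are absorbed by subtracting large multiples of
   g_j (1 - g_j)^(2k), which for large k is uniformly small where g_j >= 0 and at
   most g_j elsewhere; this leaves a form that is positive definite off the origin.
   Finally such a form is rewritten in the sums of squares |x|^2 + x_i x_j and
   |x|^2 - x_i x_j, made positive on the whole simplex by adding squares of the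
   relations between them, and a matrix version of Polya's theorem gives positive
   definite coefficients. *)

(** * Simplicial vertices of chordal graphs *)

(** Exact Gaussian elimination would divide by the pivot [P s s], while the only multiplier allowed
    is a power of |x|^2. Hence the pivot column is removed exactly and only the term b b^T / a,
    which fills in the neighbourhood of s, is approximated. A simplicial s makes this fill-in
    harmless: it stays inside one clique, so the remainder still follows the chordal graph. Every
    approximation costs some positivity, which strict definiteness pays for: by homogeneity the
    estimates are made on unit spheres, where compactness gives uniform constants. Polya's theorem
    concerns nonnegative variables and puts definite coefficients in front of monomials. Taking as
    variables forms that are themselves sums of squares turns all these monomials into sums of
    squares, and half differences of these forms are the x_i x_j, so every form of degree 2D is a
    form of degree D in them. The pieces of the decomposition need different multipliers; the
    results on blocks are therefore stated for all sufficiently large exponents, so that a common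
    one exists. *)

Lemma next_in_cat (T : eqType) (s1 s2 : seq T) (u w : T) :
  uniq (s1 ++ u :: w :: s2) -> next (s1 ++ u :: w :: s2) u = w.
Proof.
move=> Us; rewrite -(next_rot (size s1)) // rot_size_cat /=.
by rewrite eqxx.
Qed.

Lemma next_last (T : eqType) (s : seq T) (v : T) :
  uniq (v :: s) -> s != [::] -> next (v :: s) (last v s) = v.
Proof.
case/lastP: s => // s y Us _; rewrite last_rcons.
move: Us; rewrite -rcons_cons -cats1 => Us.
rewrite -(next_rot (size (v :: s))) // rot_size_cat /=.
by rewrite eqxx.
Qed.

Section Chordal.
Variables (T : finType) (e : rel T).
Hypotheses (e_sym : ssrbool.symmetric e) (e_irr : irreflexive e).
Hypothesis (e_ch : chordal e).

(** A chord of the cycle formed by v and the path cannot end at v, whose only neighbours on the path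
    are its two ends. It therefore joins two vertices of the path and shortens it, so induction on
    the length leads to an edge between the ends. *)
Lemma chordal_shortcut (v x : T) (q : seq T) :
  path e x q -> uniq [:: v, x & q] -> e v x -> e v (last x q) ->
  (forall z, z \in q -> z != last x q -> ~~ e v z) ->
  last x q != x -> e x (last x q).
Proof.
have [k] := ubnP (size q); elim: k x q => // k IH x q /ltnSE lek pq Uc evx evy qP xy.
apply: contraT => Nexy.
have [] := e_ch (c := [:: v, x & q]).
- by rewrite /ucycle Uc andbT /= evx rcons_path pq e_sym.
- case: q pq xy Nexy {qP evy lek Uc} => [|z [|w q]] //=; first by rewrite eqxx.
  by rewrite andbT => ->.
move=> a [b [ain bin eab abn abp]].
(* A chord u w with u before w lets the path skip the vertices between them; induction on the
   shorter path gives the excluded edge. *)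
have key u w : u \in x :: q -> w \in x :: q -> e u w ->
    w != next [:: v, x & q] u -> (index u (x :: q) < index w (x :: q))%N -> False.
  move=> uin win euw nuw luw.
  have: uniq (x :: q) by case/andP: Uc.
  case/splitPr def_s: {1}(x :: q) / uin => [s1 s2] Us.
  move: luw win; rewrite def_s.
  have us1 : u \notin s1.
    by move: Us; rewrite cat_uniq /= => /and3P[_ /norP[? _] _].
  rewrite index_cat (negPf us1) /= eqxx addn0 => luw win.
  have ws2 : w \in s2.
    move: win luw; rewrite mem_cat inE => /or3P[ws1|/eqP ->|//].
      rewrite index_cat ws1 => lt.
      have := index_mem w s1; rewrite ws1 => lt2.
      by have := ltn_trans lt lt2; rewrite ltnn.
    by rewrite index_cat (negPf us1) /= eqxx addn0 ltnn.
  case/splitPr: ws2 def_s Us => [s3 s4] def_s Us.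
  case: s3 def_s Us => [|z s3] def_s Us.
    move: nuw; rewrite def_s -[v :: _]cat_cons next_in_cat ?eqxx //.
    by rewrite cat_cons -def_s.
  have [q' [def_q' sub sz]] : exists q', [/\ x :: q' = s1 ++ u :: w :: s4,
      subseq q' q & (size q' < size q)%N].
    case: s1 def_s {Us us1 luw win} => [|x' s1] /= [<- ->].
      exists (w :: s4); split=> //.
        exact: (suffix_subseq (z :: s3)).
      by rewrite /= size_cat /= addnS !ltnS leq_addl.
    exists (s1 ++ u :: w :: s4); split=> //.
      apply: (@cat_subseq _ s1 [:: u, w & s4] s1 [:: u, z & s3 ++ w :: s4]) => //.
      apply: (@cat_subseq _ [:: u] (w :: s4) [:: u] (z :: s3 ++ w :: s4)) => //.
      exact: (suffix_subseq (z :: s3)).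
    by rewrite !size_cat /= size_cat /= !addnS !ltnS leq_add2l leq_addl.
  have lq' : last x q' = last x q.
    rewrite -[last x q']/(last x (x :: q')) -[last x q]/(last x (x :: q)).
    by rewrite def_q' def_s !last_cat /= last_cat.
  have pq' : path e x q'.
    rewrite -[path e x q']/(sorted e (x :: q')) def_q'.
    move: pq; rewrite -[path e x q]/(sorted e (x :: q)) def_s.
    case: (s1) => [|x' s1'] /=; rewrite !cat_path /= ?cat_path /=.
      by case/and4P=> _ _ _ ->; rewrite euw.
    by case/and5P=> -> -> _ _ /andP[_ ->]; rewrite euw.
  have := IH x q' _ pq' _ evx; rewrite lq' => H.
  move/negP: Nexy; apply; apply: H => //.
  - exact: leq_trans sz lek.
  - apply: subseq_uniq Uc; rewrite /= eqxx.
    by rewrite eqxx.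
  - by move=> t /(mem_subseq sub); exact: qP.
have Uq : uniq (x :: q) by case/andP: Uc.
have next_v : next [:: v, x & q] v = x by exact: (@next_in_cat _ [::]).
have next_y : next [:: v, x & q] (last x q) = v by exact: next_last.
have vS u w : u = v -> w \in [:: v, x & q] -> e u w ->
    w != next [:: v, x & q] u -> u != next [:: v, x & q] w -> False.
  move=> -> win evw; rewrite next_v => wx wy.
  move: win; rewrite !inE (negPf wx) /= => /orP[/eqP wv|wq].
    by rewrite wv e_irr in evw.
  have [wlast|wlast] := eqVneq w (last x q).
    by rewrite wlast next_y eqxx in wy.
  by have := qP w wq wlast; rewrite evw.
have aP : a != next [:: v, x & q] b.
  by apply: contraNneq abp => ->; rewrite prev_next.
have [av|av] := eqVneq a v; first by case: (vS a b).
have [bv|bv] := eqVneq b v; first by case: (vS b a) => //; rewrite e_sym.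
move: ain bin; rewrite inE (negPf av) /= => ain; rewrite inE (negPf bv) /= => bin.
have [lab|lab|eqab] := ltngtP (index a (x :: q)) (index b (x :: q)).
- by case: (key a b).
- by case: (key b a) => //; rewrite e_sym.
- by move: eab; rewrite -(nth_index x ain) eqab (nth_index x bin) e_irr.
Qed.

Definition closed_nbh (U : {set T}) (s : T) : {set T} := s |: [set t in U | e s t].

Lemma cliqueP (A : {set T}) :
  reflect (forall x y, x \in A -> y \in A -> x != y -> e x y) (clique e A).
Proof.
apply: (iffP forall_inP) => [H x y xA yA xy|H x xA].
  by have /forall_inP /(_ y yA) /implyP := H x xA; apply.
by apply/forall_inP => y yA; apply/implyP; apply: H.
Qed.

(** Dirac's argument: A is a component of the non-neighbours of v in U, and its boundary S consists
    of neighbours of v. Two vertices of S are joined by a path through A, which v sees only at its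
    ends, so [chordal_shortcut] makes S a clique. Keeping s away from a given vertex is what carries
    the induction: it prevents s from falling into S. *)
Lemma chordal_simplicial_away (U : {set T}) (v : T) :
  v \in U -> (exists2 w, w \in U & (w != v) && ~~ e v w) ->
  exists s, [/\ s \in U, s != v, ~~ e v s & clique e (closed_nbh U s)].
Proof.
have [k] := ubnP #|U|; elim: k U v => // k IH U v /ltnSE leU vU [w wU wv].
pose W := [set z in U | (z != v) && ~~ e v z].
have wW : w \in W by rewrite inE wU.
pose e' := [rel a b | [&& e a b, a \in W & b \in W]].
have e'_sym : connect_sym e'.
  by apply: sym_connect_sym => a b /=; rewrite e_sym [(a \in W) && _]andbC.
pose A := [set a | connect e' w a].
have AW a : a \in A -> a \in W.
  rewrite inE => /connectP[p + ->]; elim: p (w) wW => //= b p IHp c cW.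
  by case/andP=> /and3P[_ _ bW]; exact: IHp.
have wA : w \in A by rewrite inE connect0.
pose S := [set s in U | (s \notin A) && [exists a in A, e s a]].
have SP s : s \in S -> e v s.
  rewrite inE => /and3P[sU sA /exists_inP[a aA sa]].
  apply: contraR sA => vs; rewrite inE.
  have sW : s \in W.
    rewrite inE sU vs andbT /=; apply: contraTneq sa => ->.
    by have := AW _ aA; rewrite inE => /and3P[].
  move: (aA); rewrite inE => wa; apply: connect_trans wa _.
  by apply: connect1; rewrite /= e_sym sa AW.
have S_clique x y : x \in S -> y \in S -> x != y -> e x y.
  move=> xS yS xy; have [evx evy] := (SP x xS, SP y yS).
  move: (xS) (yS); rewrite !inE => /and3P[xU xA /exists_inP[a aA xa]].
  case/and3P=> [yU yA /exists_inP[b bA yb]].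
  have: connect e' a b.
    by move: aA bA; rewrite !inE e'_sym => /connect_trans; apply.
  case/connectP=> p pp lp.
  have [pe pA] : path e a p /\ {subset a :: p <= A}.
    elim: p (a) aA pp {lp} => [|c p IHp] d dA /=.
      by move=> _; split=> // z; rewrite inE => /eqP ->.
    case/andP=> /and3P[edc dW cW] pp.
    have cA : c \in A.
      move: dA; rewrite !inE => /connect_trans; apply.
      by apply: connect1; rewrite /= edc dW.
    have [-> sub] := IHp _ cA pp; split; first by rewrite edc.
    by move=> z; rewrite inE => /predU1P[->|/sub].
  have pxy : path e x (rcons (a :: p) y).
    by rewrite rcons_path /= xa pe -lp e_sym.
  have {pxy} : exists q, [/\ path e x q, uniq (x :: q), last x q = y &
       {subset q <= rcons (a :: p) y}].
    have lxy := last_rcons x (a :: p) y; case/shortenP: pxy lxy => q pq Uq sub lq.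
    by exists q.
  case=> q [pq Uq lq sub]; rewrite -lq; apply: (@chordal_shortcut v) => //.
  - rewrite [uniq _]/= -/(uniq (x :: q)) Uq andbT inE negb_or.
    rewrite (contraTneq _ evx) => [|->]; last by rewrite e_irr.
    apply/negP => /sub; rewrite mem_rcons inE => /predU1P[vy|].
      by rewrite vy e_irr in evy.
    by move/pA/AW; rewrite inE eqxx andbF.
  - by rewrite lq.
  - move=> z /sub; rewrite lq mem_rcons inE => /predU1P[->|]; first by rewrite eqxx.
    by move/pA/AW; rewrite inE => /and3P[].
  - by rewrite lq eq_sym.
(* U' misses v, so it is smaller than U; and it contains all neighbours in U of a vertex of A, so a
   vertex of A simplicial in U' is simplicial in U. *)
pose U' := A :|: S.
have vU' : v \notin U'.
  rewrite inE negb_or; apply/andP; split.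
    by apply/negP => /AW; rewrite inE eqxx andbF.
  by apply/negP => /SP; rewrite e_irr.
have ltU' : (#|U'| < k)%N.
  apply: leq_trans leU; apply: proper_card; apply/properP; split; last by exists v.
  by apply/fintype.subsetP => z; rewrite inE => /orP[/AW|]; rewrite inE => /andP[].
have nbhA a : a \in A -> closed_nbh U a \subset closed_nbh U' a.
  move=> aA; apply/fintype.subsetP => z; rewrite !in_setU1 !inE.
  case/predU1P => [->|/andP[zU az]]; first by rewrite eqxx.
  rewrite az andbT zU /=; case: (connect e' w z) => //=; rewrite ?orbT //.
  by apply/orP; right; apply/exists_inP; exists a => //; rewrite e_sym.
suff [s sA sP] : exists2 s, s \in A & clique e (closed_nbh U' s).
  have := AW _ sA; rewrite inE => /and3P[sU sv evs].
  exists s; split=> //; apply/cliqueP => x y /(fintype.subsetP (nbhA _ sA)) xU'.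
  by move=> /(fintype.subsetP (nbhA _ sA)) yU'; apply: (cliqueP _ sP).
(* The vertex to stay away from is one with a non-neighbour in U', taken in S if possible and
   otherwise in A; in both cases the vertex found cannot lie in S. If there is none, U' is complete
   and w will do. *)
have [/exists_inP[x xS /exists_inP[y yU' xy]]|noS] :=
    boolP [exists x in S, exists y in U', (y != x) && ~~ e x y].
  have [||s [sU' sx exs sP]] := IH U' x ltU'.
  - by rewrite inE xS orbT.
  - by exists y.
  exists s => //; move: sU'; rewrite inE => /orP[//|sS].
  by rewrite S_clique // eq_sym in exs.
have [/exists_inP[x xA /exists_inP[y yU' xy]]|noA] :=
    boolP [exists x in A, exists y in U', (y != x) && ~~ e x y].
  have [||s [sU' sx exs sP]] := IH U' x ltU'.
  - by rewrite inE xA.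
  - by exists y.
  exists s => //; move: (sU'); rewrite inE => /orP[//|sS].
  case/negP: noS; apply/exists_inP; exists s => //; apply/exists_inP; exists x.
    by rewrite inE xA.
  by rewrite eq_sym sx e_sym.
exists w => //; apply/cliqueP => x y xN yN xy; apply: contraT => exy.
have U'P z : z \in closed_nbh U' w -> z \in U'.
  rewrite in_setU1 => /predU1P[->|]; first by rewrite inE wA.
  by rewrite inE => /andP[].
move: (U'P x xN) (U'P y yN); rewrite [x \in U']inE => /orP[xA|xS] yU'.
  case/negP: noA; apply/exists_inP; exists x => //; apply/exists_inP; exists y => //.
  by rewrite eq_sym xy.
case/negP: noS; apply/exists_inP; exists x => //; apply/exists_inP; exists y => //.
by rewrite eq_sym xy.
Qed.

Lemma chordal_simplicial (U : {set T}) :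
  U != finset.set0 -> exists2 s, s \in U & clique e (closed_nbh U s).
Proof.
case/finset.set0Pn => v vU.
have [/exists_inP[x xU /exists_inP[y yU xy]]|no] :=
    boolP [exists x in U, exists y in U, (y != x) && ~~ e x y].
  have [|s [sU _ _ sP]] := chordal_simplicial_away xU; first by exists y.
  by exists s.
exists v => //; apply/cliqueP => x y xN yN xy; apply: contraT => exy.
have UP z : z \in closed_nbh U v -> z \in U.
  by rewrite in_setU1 inE => /predU1P[->|/andP[]].
case/negP: no; apply/exists_inP; exists x; first exact: UP.
by apply/exists_inP; exists y; [exact: UP | rewrite eq_sym xy].
Qed.
End Chordal.

(** * Compactness *)

Section Compactness.
Variable R : realType.

Lemma compact_pos_min (T : topologicalType) (Z : set T) (f : T -> R) :
  compact Z -> continuous f -> (forall z, Z z -> 0 < f z) ->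
  exists2 eps : R, 0 < eps & forall z, Z z -> eps <= f z.
Proof.
move=> cZ cf fpos; have [Z0|/set0P Z0] := eqVneq Z set0.
  by exists 1 => // z; rewrite Z0.
have [c cZin cmin] := compact_EVT_min Z0 cZ (continuous_subspaceT cf).
exists (f c); first by apply: fpos; rewrite inE in cZin.
by move=> z Zz; apply: cmin; rewrite inE.
Qed.

(** Where f <= 0, h is bounded below by a positive constant, so a large multiple of h outweighs the
    lower bound of f. Constraints enter the later estimates through this lemma, each encoded as the
    zero set of a nonnegative h. *)
Lemma compact_penalty (T : topologicalType) (Z : set T) (f h : T -> R) :
  compact Z -> continuous f -> continuous h -> (forall z, 0 <= h z) ->
  (forall z, Z z -> h z = 0 -> 0 < f z) ->
  exists2 lam : R, 0 <= lam &
    exists2 eps : R, 0 < eps & forall z, Z z -> eps <= f z + lam * h z.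
Proof.
move=> cZ cf ch h0 fpos.
suff [lam lam0 lamP] : exists2 lam : R, 0 <= lam &
    forall z, Z z -> 0 < f z + lam * h z.
  exists lam => //; apply: compact_pos_min => // z.
  by apply: cvgD; [exact: cf | apply: cvgM; [exact: cvg_cst | exact: ch]].
have [eta eta0 etaP] : exists2 eta : R, 0 < eta &
    forall z, (Z `&` [set z | f z <= 0])%classic z -> eta <= h z.
  apply: compact_pos_min => //.
    apply: compact_closedI => //.
    by apply: (closed_comp _ (@closed_le R 0)) => z _; exact: cf.
  move=> z [Zz /= fz]; rewrite lt_neqAle h0 andbT eq_sym.
  by apply/eqP => /(fpos z Zz); rewrite ltNge fz.
have [B B0 BP] : exists2 B : R, 0 < B & forall z, Z z -> - B < f z.
  have [Z0|/set0P Z0] := eqVneq Z set0; first by exists 1 => // z; rewrite Z0.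
  have [c cZin cmin] := compact_EVT_min Z0 cZ (continuous_subspaceT cf).
  exists (`|f c| + 1) => [|z Zz]; first by rewrite ltr_wpDl.
  have := cmin z; rewrite inE => /(_ Zz); have := ler_norm (- f c).
  by rewrite normrN; lra.
exists (B / eta); first by rewrite divr_ge0 ?ltW.
move=> z Zz; have [fz|fz] := ltP 0 (f z).
  by rewrite ltr_wpDr // mulr_ge0 ?h0 ?divr_ge0 ?ltW.
have : B <= B / eta * h z.
  by rewrite mulrAC -mulrA ler_peMr ?(ltW B0) // ler_pdivlMr // mul1r etaP.
by have := BP z Zz; lra.
Qed.

Lemma bounded_coord_closed_compact n (A : set 'rV[R]_n) :
  closed A -> (forall x, A x -> forall i, `|x 0 i| <= 1) -> compact A.
Proof.
move=> clA bA; have cube : compact [set x : 'rV[R]_n | forall i, `[(-1 : R), 1]%classic (x ord0 i)].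
  by apply: (@rV_compact R n (fun=> `[(-1 : R), 1]%classic)) => i; exact: segment_compact.
apply: (subclosed_compact clA cube) => x Ax i /=.
by rewrite in_itv /= -ler_norml bA.
Qed.

Lemma continuous_sum (T : topologicalType) (I : Type) (r : seq I) (P : pred I)
    (F : I -> T -> R) : (forall i, P i -> continuous (F i)) ->
  continuous (fun z => \sum_(i <- r | P i) F i z).
Proof. by move=> cF; apply: continuous_big => //; exact: add_continuous. Qed.

Lemma continuous_prod (T : topologicalType) (I : Type) (r : seq I) (P : pred I)
    (F : I -> T -> R) : (forall i, P i -> continuous (F i)) ->
  continuous (fun z => \prod_(i <- r | P i) F i z).
Proof. by move=> cF; apply: continuous_big => //; exact: mul_continuous. Qed.

Lemma continuous_mul (T : topologicalType) (f g : T -> R) :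
  continuous f -> continuous g -> continuous (fun z => f z * g z).
Proof. by move=> cf cg z; apply: cvgM; [exact: cf | exact: cg]. Qed.

Lemma continuous_add (T : topologicalType) (f g : T -> R) :
  continuous f -> continuous g -> continuous (fun z => f z + g z).
Proof. by move=> cf cg z; apply: cvgD; [exact: cf | exact: cg]. Qed.

Lemma continuous_exp (T : topologicalType) (f : T -> R) k :
  continuous f -> continuous (fun z => f z ^+ k).
Proof.
move=> cf; elim: k => [|k IH]; first by move=> z; exact: cvg_cst.
have -> : (fun z => f z ^+ k.+1) = (fun z => f z * f z ^+ k).
  by apply/funext => z; rewrite exprS.
exact: continuous_mul.
Qed.

Lemma continuous_coord (T : topologicalType) n (x : T -> 'rV[R]_n) (i : 'I_n) :
  continuous x -> continuous (fun z => x z 0 i).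
Proof.
move=> cx z.
apply: (@continuous_comp _ _ _ x (fun y : 'rV[R]_n => y 0 i) z (cx z)).
exact: coord_continuous.
Qed.

Lemma continuous_meval (T : topologicalType) n (p : {mpoly R[n]}) (x : T -> 'rV[R]_n) :
  continuous x -> continuous (fun z => p.@[x z 0]).
Proof.
move=> cx; have -> : (fun z => p.@[x z 0]) =
    (fun z => \sum_(m <- msupp p) p@_m * \prod_i x z 0 i ^+ m i).
  by apply/funext => z; rewrite mevalE.
apply: continuous_sum => m _; apply: continuous_mul; first by move=> z; exact: cvg_cst.
by apply: continuous_prod => i _; apply/continuous_exp/continuous_coord.
Qed.

Definition sqn n (x : 'rV[R]_n) : R := \sum_i x 0 i ^+ 2.

Definition qform m (M : 'M[R]_m) (v : 'rV[R]_m) : R := (v *m M *m v^T) 0 0.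

Lemma qformE m (M : 'M[R]_m) v : qform M v = \sum_j \sum_i v 0 i * M i j * v 0 j.
Proof.
rewrite /qform mxE; apply: eq_bigr => j _; rewrite !mxE mulr_suml.
by apply: eq_bigr => i _.
Qed.

Lemma continuous_qform (T : topologicalType) n m (P : 'M[{mpoly R[n]}]_m)
    (x : T -> 'rV[R]_n) (v : T -> 'rV[R]_m) :
  continuous x -> continuous v ->
  continuous (fun z => qform (eval_mx P (x z)) (v z)).
Proof.
move=> cx cv; have -> : (fun z => qform (eval_mx P (x z)) (v z)) =
    (fun z => \sum_j \sum_i v z 0 i * (P i j).@[x z 0] * v z 0 j).
  apply/funext => z; rewrite qformE; apply: eq_bigr => j _; apply: eq_bigr => i _.
  by rewrite mxE.
apply: continuous_sum => j _; apply: continuous_sum => i _.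
by do 2?apply: continuous_mul; try exact: continuous_coord; exact: continuous_meval.
Qed.

Lemma continuous_sqn (T : topologicalType) n (x : T -> 'rV[R]_n) :
  continuous x -> continuous (fun z => sqn (x z)).
Proof.
by move=> cx; apply: continuous_sum => i _; apply/continuous_exp/continuous_coord.
Qed.

Lemma sphere_compact n : compact [set x : 'rV[R]_n | sqn x = 1].
Proof.
apply: bounded_coord_closed_compact => [|x /= x1 i].
  apply: (closed_comp _ (@closed_eq R 1)) => z _.
  exact: (continuous_sqn (fun x => @cvg_id _ _)).
rewrite -(@expr_le1 _ 2) // real_normK ?num_real // -x1 /sqn (bigD1 i) //=.
by rewrite lerDl sumr_ge0 // => j _; rewrite sqr_ge0.
Qed.

Lemma simplex_compact n :
  compact [set y : 'rV[R]_n | (forall i, 0 <= y 0 i) /\ \sum_i y 0 i = 1].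
Proof.
apply: bounded_coord_closed_compact => [|x /= [x0 x1] i].
  have -> : [set y : 'rV[R]_n | (forall i, 0 <= y 0 i) /\ \sum_i y 0 i = 1]%classic =
      ((\bigcap_(i in [set: 'I_n]) [set y : 'rV[R]_n | 0 <= y 0 i]) `&`
       [set y : 'rV[R]_n | \sum_i y 0 i = 1])%classic.
    by apply/seteqP; split=> y /= [H ?]; split=> // i; [move=> _; exact: H|exact: (H i I)].
  apply: closedI.
    apply: closed_bigI => i _.
    by apply: (closed_comp _ (@closed_ge R 0)) => z _; exact: coord_continuous.
  apply: (closed_comp _ (@closed_eq R 1)) => z _.
  by apply: continuous_sum => i _; exact: coord_continuous.
rewrite ger0_norm // -x1 (bigD1 i) //=.
by rewrite lerDl sumr_ge0.
Qed.

End Compactness.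

(** * Quadratic forms *)

Section QuadraticForms.
Variable R : realType.

Lemma qformD m (M N : 'M[R]_m) v : qform (M + N) v = qform M v + qform N v.
Proof. by rewrite /qform mulmxDr mulmxDl mxE. Qed.

Lemma qformZ m (M : 'M[R]_m) a v : qform (a *: M) v = a * qform M v.
Proof. by rewrite /qform -scalemxAr -scalemxAl mxE. Qed.

Lemma qformB m (M N : 'M[R]_m) v : qform (M - N) v = qform M v - qform N v.
Proof. by rewrite -scaleN1r qformD qformZ mulN1r. Qed.

Lemma qform_sum m (I : Type) (r : seq I) (P : pred I) (M : I -> 'M[R]_m) v :
  qform (\sum_(i <- r | P i) M i) v = \sum_(i <- r | P i) qform (M i) v.
Proof.
elim/big_rec2: _ => [|i x y _ <-]; last by rewrite qformD.
by rewrite /qform mulmx0 mul0mx mxE.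
Qed.

Lemma qform_scale m (M : 'M[R]_m) a v : qform M (a *: v) = a ^+ 2 * qform M v.
Proof.
by rewrite /qform linearZ /= -!scalemxAl -scalemxAr !mxE; ring.
Qed.

Lemma qform_scalar m (a : R) (v : 'rV[R]_m) : qform a%:M v = a * sqn v.
Proof.
rewrite /qform mul_mx_scalar -scalemxAl mxE; congr (_ * _).
by rewrite mxE; apply: eq_bigr => i _; rewrite mxE expr2.
Qed.

Lemma sqn_ge0 m (v : 'rV[R]_m) : 0 <= sqn v.
Proof. by apply: sumr_ge0 => i _; exact: sqr_ge0. Qed.

Lemma sqn_eq0 m (v : 'rV[R]_m) : (sqn v == 0) = (v == 0).
Proof.
apply/eqP/eqP => [v0|->]; last by apply: big1 => i _; rewrite mxE expr0n.
apply/rowP => i; rewrite mxE; apply/eqP; rewrite -sqrf_eq0; apply/eqP.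
by apply: (psumr_eq0P _ v0) => // j _; exact: sqr_ge0.
Qed.

Lemma sqn_gt0 m (v : 'rV[R]_m) : (0 < sqn v) = (v != 0).
Proof. by rewrite lt_neqAle sqn_ge0 andbT eq_sym sqn_eq0. Qed.

Lemma sqnZ m a (v : 'rV[R]_m) : sqn (a *: v) = a ^+ 2 * sqn v.
Proof.
by rewrite /sqn mulr_sumr; apply: eq_bigr => i _; rewrite mxE exprMn.
Qed.

Lemma unit_scaling m (v : 'rV[R]_m) : v != 0 ->
  exists2 a : R, 0 < a & sqn (a *: v) = 1.
Proof.
rewrite -sqn_gt0 => v0; exists (Num.sqrt (sqn v))^-1.
  by rewrite invr_gt0 sqrtr_gt0.
by rewrite sqnZ exprVn sqr_sqrtr ?ltW // mulVf // gt_eqF.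
Qed.

Lemma posdef_qform m (M : 'M[R]_m) :
  posdef M <-> forall v : 'rV[R]_m, v != 0 -> 0 < qform M v.
Proof.
split=> H v v0; last by have := H v^T; rewrite /qform trmxK trmx_eq0; apply.
by have := H v^T; rewrite trmxK trmx_eq0; apply.
Qed.

Lemma posdef_sqnP m (M : 'M[R]_m) :
  (forall v, sqn v = 1 -> 0 < qform M v) -> posdef M.
Proof.
move=> H; apply/posdef_qform => v /unit_scaling[a a0 /H].
by rewrite qform_scale pmulr_rgt0 // exprn_gt0.
Qed.

(** At the vector (- a^-1 w b, w) the form of M equals the form of the Schur complement at w, which
    is therefore positive definite and has a factor by induction. *)
Lemma posdef_cholesky m (M : 'M[R]_m) :
  M^T = M -> posdef M -> exists H : 'M[R]_m, M = H^T *m H.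
Proof.
elim: m M => [|m IH] M symM /posdef_qform pM; first by exists 0; rewrite flatmx0 [RHS]flatmx0.
move: M symM pM; rewrite -[m.+1]/(1 + m)%N => M symM pM.
pose a := M 0 0; pose b := dlsubmx M; pose D := drsubmx M.
have ulM : ulsubmx M = a%:M.
  by apply/matrixP => i j; rewrite !ord1 !mxE eqxx mulr1n; congr (M _ _); apply/val_inj.
have urM : ursubmx M = b^T by rewrite -[LHS]trmxK trmx_ursub symM.
have DT : D^T = D by rewrite /D trmx_drsub symM.
have defM : M = block_mx a%:M b^T b D by rewrite -ulM -urM submxK.
have a0 : 0 < a.
  have := pM (delta_mx 0 0); rewrite /qform trmx_delta -rowE -colE !mxE; apply.
  by apply/eqP => /matrixP/(_ 0 0); rewrite !mxE !eqxx => /eqP; rewrite oner_eq0.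
have [||H defS] := IH (D - a^-1 *: (b *m b^T)).
- by rewrite linearB linearZ /= trmx_mul trmxK DT.
- apply/posdef_qform => w w0.
  have := pM (row_mx (- a^-1 *: (w *m b)) w).
  rewrite defM /qform mul_row_block tr_row_mx mul_row_col mul_mx_scalar scalerA.
  rewrite mulrN mulfV ?gt_eqF // scaleN1r addNr mul0mx add0r.
  have -> : (- a^-1 *: (w *m b)) *m b^T + w *m D = w *m (D - a^-1 *: (b *m b^T)).
    by rewrite mulmxBr -scalemxAl scaleNr -mulmxA -scalemxAr addrC.
  by apply; apply: contraNneq w0; rewrite -row_mx0 => /eq_row_mx[_ ->].
exists (block_mx (Num.sqrt a)%:M ((Num.sqrt a)^-1 *: b^T) 0 H).
rewrite tr_block_mx mulmx_block !trmx0 !mul0mx !mulmx0 !addr0 -defS.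
have bT : ((Num.sqrt a)^-1 *: b^T)^T = (Num.sqrt a)^-1 *: b by rewrite linearZ /= trmxK.
rewrite tr_scalar_mx bT -scalar_mxM -expr2 sqr_sqrtr ?ltW //.
have sa : Num.sqrt a != 0 by rewrite gt_eqF // sqrtr_gt0.
rewrite mul_scalar_mx scalerA mulfV // scale1r mul_mx_scalar scalerA mulfV // scale1r.
rewrite -scalemxAl -scalemxAr scalerA -expr2 exprVn sqr_sqrtr ?ltW //.
by rewrite addrC subrK.
Qed.
End QuadraticForms.

(** * Sums of squares and homogeneous matrices *)

Section SumsOfSquares.
Variables (R : realType) (n : nat).
Local Notation poly := {mpoly R[n]}.
Implicit Types (p q : poly).

Definition sos_poly p : Prop := exists s : seq poly, p = \sum_(q <- s) q ^+ 2.

Lemma sos_sqr p : sos_poly (p ^+ 2).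
Proof. by exists [:: p]; rewrite big_seq1. Qed.

Lemma sos1 : sos_poly 1.
Proof. by exists [:: 1]; rewrite big_seq1 expr1n. Qed.

Lemma sosD p q : sos_poly p -> sos_poly q -> sos_poly (p + q).
Proof. by move=> [s ->] [t ->]; exists (s ++ t); rewrite big_cat. Qed.

Lemma sosM p q : sos_poly p -> sos_poly q -> sos_poly (p * q).
Proof.
move=> [s ->] [t ->]; exists [seq a * b | a <- s, b <- t].
rewrite big_allpairs_dep /= mulr_suml; apply: eq_bigr => a _.
by rewrite mulr_sumr; apply: eq_bigr => b _; rewrite exprMn.
Qed.

Lemma sos_sum (I : Type) (r : seq I) (P : pred I) (F : I -> poly) :
  (forall i, P i -> sos_poly (F i)) -> sos_poly (\sum_(i <- r | P i) F i).
Proof.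
move=> HF; apply: (big_ind sos_poly) => //; last exact: sosD.
by exists [::]; rewrite big_nil.
Qed.

Lemma sos_prod (I : Type) (r : seq I) (P : pred I) (F : I -> poly) :
  (forall i, P i -> sos_poly (F i)) -> sos_poly (\prod_(i <- r | P i) F i).
Proof.
move=> HF; apply: (big_ind sos_poly) => //; last exact: sosM.
exact: sos1.
Qed.

Lemma sosX p k : sos_poly p -> sos_poly (p ^+ k).
Proof.
move=> sp; elim: k => [|k IH]; last by rewrite exprS; exact: sosM.
exact: sos1.
Qed.

Lemma sosZ (c : R) p : 0 <= c -> sos_poly p -> sos_poly (c *: p).
Proof.
move=> c0 sp; rewrite -mul_mpolyC; apply: sosM => //.
rewrite -(sqr_sqrtr c0) rmorphXn; exact: sos_sqr.
Qed.

Lemma sos_sqnorm : sos_poly (sqnorm_mpoly R n).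
Proof. by apply: sos_sum => i _; exact: sos_sqr. Qed.

Lemma sos_mx0 m : sos_mx (0 : 'M[poly]_m).
Proof. by exists 0%N, 0; rewrite mulmx0. Qed.

Lemma sos_mxD m (S T : 'M[poly]_m) : sos_mx S -> sos_mx T -> sos_mx (S + T).
Proof.
move=> [r [H ->]] [s [K ->]]; exists (r + s)%N, (col_mx H K).
by rewrite tr_col_mx mul_row_col.
Qed.

Lemma sos_mx_sum m (I : Type) (r : seq I) (P : pred I) (F : I -> 'M[poly]_m) :
  (forall i, P i -> sos_mx (F i)) -> sos_mx (\sum_(i <- r | P i) F i).
Proof.
move=> HF; apply: (big_ind (@sos_mx R n m)) => //; [exact: sos_mx0 | exact: sos_mxD].
Qed.

Lemma sos_mxZ m p (S : 'M[poly]_m) : sos_poly p -> sos_mx S -> sos_mx (p *: S).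
Proof.
move=> [s ->] [r [H ->]]; rewrite scaler_suml; apply: sos_mx_sum => q _.
exists r, (q *: H); have -> : (q *: H)^T = q *: H^T by apply/matrixP => i j; rewrite !mxE.
by rewrite -scalemxAl -scalemxAr scalerA expr2.
Qed.

Lemma sos_mx_congr m k (S : 'M[poly]_m) (E : 'M[poly]_(m, k)) :
  sos_mx S -> sos_mx (E^T *m S *m E).
Proof. by move=> [r [H ->]]; exists r, (H *m E); rewrite trmx_mul !mulmxA. Qed.

Lemma sos_scalar_mx m p : sos_poly p -> sos_mx (p%:M : 'M[poly]_m).
Proof.
move=> sp; rewrite -scalemx1; apply: sos_mxZ => //.
by exists m, 1%:M; rewrite trmx1 mulmx1.
Qed.

Definition constmx m k (B : 'M[R]_(m, k)) : 'M[poly]_(m, k) := map_mx (@mpolyC n R) B.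

Lemma constmxZ m k c (B : 'M[R]_(m, k)) : constmx (c *: B) = c%:MP *: constmx B.
Proof. by apply/matrixP => i j; rewrite !mxE mpolyCM. Qed.

Lemma constmx_sum m k (I : Type) (r : seq I) (P : pred I) (B : I -> 'M[R]_(m, k)) :
  constmx (\sum_(i <- r | P i) B i) = \sum_(i <- r | P i) constmx (B i).
Proof. by rewrite /constmx raddf_sum. Qed.

Lemma sos_constmx m (B : 'M[R]_m) : B^T = B -> posdef B -> sos_mx (constmx B).
Proof.
move=> symB /posdef_cholesky - /(_ symB) [H ->]; exists m, (constmx H).
by rewrite /constmx map_mxM map_trmx.
Qed.

Lemma homog_scale d p (x : 'rV[R]_n) t :
  p \is d.-homog -> p.@[(t *: x) 0] = t ^+ d * p.@[x 0].
Proof.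
move=> /dhomogP hp; rewrite !mevalE mulr_sumr; apply: eq_big_seq => m mp.
rewrite mulrCA; congr (_ * _); rewrite -(hp m mp) /= mdegE -prodrXr -big_split /=.
by apply: eq_bigr => i _; rewrite mxE exprMn.
Qed.

Lemma homog_sum d (I : Type) (r : seq I) (P : pred I) (F : I -> poly) :
  (forall i, P i -> F i \is d.-homog) -> \sum_(i <- r | P i) F i \is d.-homog.
Proof. by move=> HF; apply: rpred_sum. Qed.

Lemma homog_prod_const (I : finType) e (F : I -> poly) :
  (forall i, F i \is e.-homog) -> \prod_i F i \is (e * #|I|).-homog.
Proof.
move=> HF; rewrite cardE -big_enum /=; elim: (enum I) => [|i s IH].
  by rewrite big_nil muln0 dhomog1.
by rewrite big_cons /= mulnS; exact: dhomogM.
Qed.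

Lemma homogXU i : ('X_i : poly) \is 1.-homog.
Proof. by rewrite dhomogX /= mdeg1. Qed.

Lemma homog_sqnorm k : sqnorm_mpoly R n ^+ k \is (k.*2).-homog.
Proof.
rewrite -mul2n; apply: dhomogMn; apply: homog_sum => i _.
by apply: (@dhomogMn _ _ _ 1); exact: homogXU.
Qed.

Lemma homogMd d e f p q : p \is d.-homog -> q \is e.-homog -> (d + e = f)%N ->
  p * q \is f.-homog.
Proof. by move=> hp hq <-; exact: dhomogM. Qed.

Lemma sqnorm_eval (x : 'rV[R]_n) : (sqnorm_mpoly R n).@[x 0] = sqn x.
Proof.
rewrite /sqnorm_mpoly raddf_sum /=; apply: eq_bigr => i _.
by rewrite rmorphXn /= mevalXU.
Qed.

Lemma eval_mxD m (P Q : 'M[poly]_m) x : eval_mx (P + Q) x = eval_mx P x + eval_mx Q x.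
Proof. by apply/matrixP => i j; rewrite !mxE mevalD. Qed.

Lemma eval_mxB m (P Q : 'M[poly]_m) x : eval_mx (P - Q) x = eval_mx P x - eval_mx Q x.
Proof. by apply/matrixP => i j; rewrite !mxE mevalB. Qed.

Lemma eval_mxZ m p (P : 'M[poly]_m) x : eval_mx (p *: P) x = p.@[x 0] *: eval_mx P x.
Proof. by apply/matrixP => i j; rewrite !mxE mevalM. Qed.

Lemma eval_mx_scalar m p x : eval_mx (p%:M : 'M[poly]_m) x = (p.@[x 0])%:M.
Proof. by apply/matrixP => i j; rewrite !mxE mevalMn. Qed.

Lemma eval_mx_sum m (I : Type) (r : seq I) (P : pred I) (F : I -> 'M[poly]_m) x :
  eval_mx (\sum_(i <- r | P i) F i) x = \sum_(i <- r | P i) eval_mx (F i) x.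
Proof.
elim/big_rec2: _ => [|i y z _ <-]; last by rewrite eval_mxD.
by apply/matrixP => i j; rewrite !mxE meval0.
Qed.

Lemma eval_mx_homog m d (P : 'M[poly]_m) x t :
  homog_mx d P -> eval_mx P (t *: x) = t ^+ d *: eval_mx P x.
Proof. by move=> hP; apply/matrixP => i j; rewrite !mxE (homog_scale _ _ (hP i j)). Qed.

Lemma homog_mxD m d (P Q : 'M[poly]_m) : homog_mx d P -> homog_mx d Q -> homog_mx d (P + Q).
Proof. by move=> hP hQ i j; rewrite mxE rpredD. Qed.

Lemma homog_mxB m d (P Q : 'M[poly]_m) : homog_mx d P -> homog_mx d Q -> homog_mx d (P - Q).
Proof. by move=> hP hQ i j; rewrite !mxE rpredB. Qed.

Lemma homog_mxZ m d e f p (P : 'M[poly]_m) : p \is d.-homog -> homog_mx e P ->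
  (d + e = f)%N -> homog_mx f (p *: P).
Proof. by move=> hp hP <- i j; rewrite mxE dhomogM. Qed.

Lemma homog_mx_scalar m d p : p \is d.-homog -> homog_mx d (p%:M : 'M[poly]_m).
Proof. by move=> hp i j; rewrite mxE; case: (i == j); rewrite ?mulr1n ?mulr0n ?dhomog0. Qed.

Lemma homog_mx_sum m d (I : Type) (r : seq I) (P : pred I) (F : I -> 'M[poly]_m) :
  (forall i, P i -> homog_mx d (F i)) -> homog_mx d (\sum_(i <- r | P i) F i).
Proof.
move=> HF; apply: (big_ind (@homog_mx R n d m)) => //; last exact: homog_mxD.
by move=> i j; rewrite mxE dhomog0.
Qed.

Lemma homog_mx_congr m k d (P : 'M[poly]_m) (E : 'M[R]_(m, k)) :
  homog_mx d P -> homog_mx d ((constmx E)^T *m P *m constmx E).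
Proof.
move=> hP i j; rewrite mxE; apply: homog_sum => a _; rewrite mxE mulr_suml.
apply: homog_sum => b _; rewrite !mxE mulrC mul_mpolyC mul_mpolyC.
by do 2!apply: dhomogZ.
Qed.

End SumsOfSquares.

(** * Polya's theorem for matrix forms *)

Section Polya.
Variable R : realType.

(** Words replace exponent vectors: Polya's expansion then involves no multinomial coefficients and
    becomes a count of maps between positions. *)
Lemma monomial_word N (m : 'X_{1..N}) :
  exists w : {ffun 'I_(mdeg m) -> 'I_N},
    'X_[m] = \prod_i 'X_(w i) :> {mpoly R[N]}.
Proof.
have [s [sz ->]] : exists s : seq 'I_N,
    size s = mdeg m /\ 'X_[m] = \prod_(i <- s) 'X_i :> {mpoly R[N]}.
  rewrite mdegE mpolyXE_id; elim/big_rec2: _ => [|i y x _ [s [<- ->]]].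
    by exists [::]; rewrite big_nil.
  exists (nseq (m i) i ++ s); rewrite size_cat size_nseq; split=> //.
  by rewrite big_cat big_nseq /= iter_mulr_1.
rewrite -sz; exists [ffun i => tnth (in_tuple s) i].
by rewrite big_tnth; apply: eq_bigr => i _; rewrite ffunE.
Qed.

Lemma homog_word D N (p : {mpoly R[N]}) : p \is D.-homog ->
  exists a : {ffun 'I_D -> 'I_N} -> R, p = \sum_w a w *: \prod_i 'X_(w i).
Proof.
move=> /dhomogP hp; rewrite [p]mpolyE big_seq.
pose ok (q : {mpoly R[N]}) := exists a : {ffun 'I_D -> 'I_N} -> R,
  q = \sum_w a w *: \prod_i 'X_(w i).
apply: (big_ind ok) => [|_ _ [a ->] [b ->]|m /hp /= Dm].
- by exists (fun=> 0); rewrite big1 // => w _; rewrite scale0r.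
- by exists (fun w => a w + b w); rewrite -big_split; apply: eq_bigr => w _; rewrite scalerDl.
have [w ->] := monomial_word m; move: w; rewrite Dm => w.
exists (fun w' => p@_m * (w' == w)%:R); rewrite (bigD1 w) //= eqxx mulr1 [X in _ + X]big1 ?addr0 //.
by move=> w' /negPf ->; rewrite mulr0 scale0r.
Qed.

Lemma ffact_leq_exp L D : (L ^_ D <= L ^ D)%N.
Proof.
elim: D => [|D IH]; first by rewrite ffactn0.
by rewrite ffactnSr expnSr leq_mul ?leq_subr.
Qed.

(** Written without division, this bounds by D^2 / L the share of non-injective maps among all maps
    from D positions to L positions. *)
Lemma ffact_lower_bound L D : (L * L ^ D <= L * L ^_ D + D ^ 2 * L ^ D)%N.
Proof.
elim: D => [|D IH]; first by rewrite ffactn0 leq_addr.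
have h := ffact_leq_exp L D.
have h1 : (L * L ^_ D <= L ^_ D.+1 + D * L ^_ D)%N.
  by rewrite ffactnSr mulnC [(D * _)%N]mulnC -mulnDr leq_mul2l addnC -leq_subLR leqnn orbT.
rewrite expnSr; move: (L ^_ D) (L ^ D)%N (L ^_ D.+1) IH h h1 => x y z IH h h1.
apply: (@leq_trans (L * (L * x + D ^ 2 * y))).
  by rewrite leq_mul2l [(y * L)%N]mulnC IH orbT.
rewrite [leqLHS]mulnDr.
apply: (@leq_trans (L * (z + D * x) + L * (D ^ 2 * y))).
  by rewrite leq_add2r leq_mul2l h1 orbT.
rewrite [(L * (_ + _))%N]mulnDr -addnA leq_add2l.
apply: (@leq_trans (L * (D * y) + L * (D ^ 2 * y))).
  by rewrite leq_add2r !leq_mul2l h !orbT.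
rewrite -mulnDr [(_ * (y * L))%N]mulnA [leqRHS]mulnC leq_mul2l -mulnDl leq_mul2r.
by rewrite !expnS !expn0; lia.
Qed.

Lemma qform_bound m (M : 'M[R]_m) v : sqn v = 1 ->
  `|qform M v| <= \sum_j \sum_i `|M i j|.
Proof.
move=> v1; have vi i : `|v 0 i| <= 1.
  rewrite -(@expr_le1 _ 2) // real_normK ?num_real // -v1 /sqn (bigD1 i) //=.
  by rewrite lerDl sumr_ge0 // => j _; rewrite sqr_ge0.
rewrite qformE; apply: le_trans (ler_norm_sum _ _ _) _; apply: ler_sum => j _.
apply: le_trans (ler_norm_sum _ _ _) _; apply: ler_sum => i _.
rewrite !normrM mulrAC -[leRHS]mul1r ler_wpM2r //.
by rewrite mulr_ile1.
Qed.

Variables (D N m : nat) (a : {ffun 'I_D -> 'I_N} -> 'M[R]_m).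

Definition wcomp L (W : {ffun 'I_L -> 'I_N}) (f : {ffun 'I_D -> 'I_L}) :
  {ffun 'I_D -> 'I_N} := [ffun k => W (f k)].

(** Fixing the subword w of W along f prescribes D of the L letters of W, which gives the monomial
    of w; the other L - D letters are free, and each contributes the sum of all variables. *)
Lemma sum_words_along_injection L (f : {ffun 'I_D -> 'I_L}) n (y : 'I_N -> {mpoly R[n]}) :
  injective f ->
  \sum_(W : {ffun 'I_L -> 'I_N}) (\prod_l y (W l)) *: constmx n (a (wcomp W f)) =
  (\sum_i y i) ^+ (L - D) *: \sum_(w : {ffun 'I_D -> 'I_N}) (\prod_k y (w k)) *: constmx n (a w).
Proof.
move=> f_inj; rewrite (partition_big (fun W => wcomp W f) predT) //= scaler_sumr.
apply: eq_bigr => w _; rewrite scalerA.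
rewrite (eq_bigr (fun W : {ffun 'I_L -> 'I_N} => (\prod_l y (W l)) *: constmx n (a w)));
  last by move=> W /eqP ->.
rewrite -scaler_suml; congr (_ *: _).
pose Q (l : 'I_L) (i : 'I_N) := [forall k, (f k == l) ==> (w k == i)].
transitivity (\sum_(W in family Q) \prod_l y (W l)).
  apply: eq_bigl => W; apply/eqP/familyP => [Ww l|WQ].
    by apply/forallP => k; apply/implyP => /eqP <-; rewrite -Ww ffunE.
  apply/ffunP => k; rewrite ffunE.
  by have /forallP/(_ k) := WQ (f k); rewrite eqxx /= => /eqP.
rewrite -(@bigA_distr_big_dep _ _ _ _ _ _ _ Q (fun _ i => y i)).
rewrite (bigID (mem [set f k | k in 'I_D])) /= mulrC; congr (_ * _).
  rewrite (eq_bigr (fun=> \sum_i y i)) => [|l lf].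
    rewrite prodr_const; congr (_ ^+ _).
    rewrite (eq_card (B := ~: [set f k | k in 'I_D])) => [|l]; last by rewrite !inE.
    by rewrite cardsCs finset.setCK card_imset // !card_ord.
  apply: eq_bigl => i; apply/forallP => k; apply/implyP => /eqP fk.
  by case/negP: lf; rewrite -fk imset_f.
rewrite big_imset /=; last by move=> ? ? _ _; exact: f_inj.
apply: eq_bigr => k _; rewrite (eq_bigl (pred1 (w k))) ?big_pred1_eq // => i /=.
apply/forallP/eqP => [/(_ k)|-> k']; first by rewrite eqxx => /eqP.
by rewrite (inj_eq f_inj); apply/implyP => /eqP ->.
Qed.

(** The number of f that read w in W is the product over k of the number of occurrences of w k in W,
    that is, L^D times a product of letter frequencies. *)
Lemma sum_words_along_maps L (W : {ffun 'I_L -> 'I_N}) : (0 < L)%N ->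
  \sum_(f : {ffun 'I_D -> 'I_L}) a (wcomp W f) =
  (L ^ D)%:R *: \sum_(w : {ffun 'I_D -> 'I_N})
     (\prod_k (\sum_l (W l == w k)%:R / L%:R)) *: a w.
Proof.
move=> L0; rewrite scaler_sumr (partition_big (wcomp W) predT) //=.
apply: eq_bigr => w _; rewrite scalerA.
rewrite (eq_bigr (fun=> a w)) => [|f /eqP -> //].
rewrite bigA_distr_bigA /= mulr_sumr scaler_suml big_mkcond; apply: eq_bigr => f _.
rewrite natrX; have [<-|nW] := eqVneq.
  rewrite (eq_bigr (fun=> L%:R^-1)) => [|k _]; last by rewrite ffunE eqxx mul1r.
  rewrite prodr_const card_ord exprVn mulfV ?scale1r // expf_neq0 //.
  by rewrite pnatr_eq0 -lt0n.
have [k /negPf nk] : exists k, W (f k) != w k.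
  apply/existsP; apply: contraNT nW; rewrite negb_exists => /forallP H.
  by apply/eqP/ffunP => k; rewrite ffunE; apply/eqP; have := H k; rewrite negbK.
by rewrite (bigD1 k) //= nk mul0r mul0r mulr0 scale0r.
Qed.

(* The new coefficient of the word W averages the coefficients of its subwords
   W \o f over all injections f.  Over all maps f the average would be the form at
   the letter frequencies of W, and for large L almost all maps are injective. *)
Lemma matrix_polya (eps : R) :
  (forall w, (a w)^T = a w) -> 0 < eps ->
  (forall (y : 'I_N -> R) v, (forall i, 0 <= y i) -> \sum_i y i = 1 -> sqn v = 1 ->
     eps <= qform (\sum_(w : {ffun 'I_D -> 'I_N}) (\prod_k y (w k)) *: a w) v) ->
  exists (L : nat) (B : {ffun 'I_L -> 'I_N} -> 'M[R]_m),
    [/\ (D <= L)%N, forall W, (B W)^T = B W, forall W, posdef (B W) &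
     forall n (y : 'I_N -> {mpoly R[n]}),
       \sum_(W : {ffun 'I_L -> 'I_N}) (\prod_l y (W l)) *: constmx n (B W) =
       (\sum_i y i) ^+ (L - D) *:
         \sum_(w : {ffun 'I_D -> 'I_N}) (\prod_k y (w k)) *: constmx n (a w)].
Proof.
move=> a_sym eps0 aP.
pose c := \sum_w \sum_j \sum_i `|a w i j|.
have c0 : 0 <= c by do 3!apply: sumr_ge0 => ? _.
have cP w v : sqn v = 1 -> qform (a w) v <= c.
  move=> v1; apply: le_trans (ler_norm _) _; apply: le_trans (qform_bound _ v1) _.
  by rewrite /c (bigD1 w) //= lerDl; do 3!apply: sumr_ge0 => ? _.
have [L [leDL L0 LP]] : exists L : nat, [/\ (D <= L)%N, (0 < L)%N &
    c * ((L ^ D)%:R - (L ^_ D)%:R) < eps * (L ^ D)%:R].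
  have cD0 : 0 <= c * (D ^ 2)%:R / eps.
    by apply: divr_ge0; [apply: mulr_ge0 | exact: ltW].
  have := archi_boundP cD0; set b := Num.bound _ => bP.
  (* As b exceeds c D^2 / eps, the non-injective maps, each worth at most c, weigh less than eps on
     average over all maps; the summand [D.+1] ensures D <= L and 0 < L. *)
  pose L := (D.+1 + b)%N.
  have L0 : 0 < L%:R :> R by rewrite ltr0n.
  exists L; split; [by rewrite /L addSn leqW ?leq_addr | by [] |].
  have LDb : 0 < (L ^ D)%:R :> R by rewrite natrX exprn_gt0.
  rewrite -(ltr_pM2l L0) mulrCA.
  have := ffact_lower_bound L D.
  rewrite -(ler_nat R) natrD (natrM _ L) (natrM _ L) (natrM _ (D ^ 2)) => h.
  apply: (@le_lt_trans _ _ (c * ((D ^ 2)%:R * (L ^ D)%:R))).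
    by rewrite ler_wpM2l // mulrBr lerBlDr addrC.
  rewrite !mulrA ltr_pM2r //; move: bP; rewrite ltr_pdivrMr // => /lt_le_trans; apply.
  by rewrite ler_wpM2r ?(ltW eps0) // ler_nat /L leq_addl.
pose inj := [set f : {ffun 'I_D -> 'I_L} | injectiveb f].
pose B W := (L ^_ D)%:R^-1 *: \sum_(f in inj) a (wcomp W f).
have card_inj : #|inj| = (L ^_ D)%N by rewrite card_inj_ffuns !card_ord.
have ff0 : 0 < (L ^_ D)%:R :> R by rewrite ltr0n ffact_gt0.
exists L, B; split=> // [W|W|n y].
- rewrite /B linearZ /= linear_sum /=; congr (_ *: _); apply: eq_bigr => f _; exact: a_sym.
- apply: posdef_sqnP => v v1; rewrite qformZ mulr_gt0 ?invr_gt0 //.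
  rewrite qform_sum; pose y i : R := \sum_l (W l == i)%:R / L%:R.
  have y0 i : 0 <= y i by apply: sumr_ge0 => l _; rewrite divr_ge0.
  have y1 : \sum_i y i = 1.
    rewrite exchange_big /= (eq_bigr (fun=> L%:R^-1)) => [|l _].
      by rewrite sumr_const card_ord -[_ *+ L]mulr_natr mulVf // pnatr_eq0 -lt0n.
    rewrite -mulr_suml (bigD1 (W l)) //= eqxx big1 ?addr0 ?mul1r // => i.
    by rewrite eq_sym => /negPf ->.
  have yP := aP y v y0 y1 v1.
  (* The frequencies y form a point of the simplex, so all maps together contribute at least L^D
     eps. The non-injective ones account for less than that, hence the injective ones have a
     positive sum. *)
  have tot : (L ^ D)%:R * eps <= \sum_(f : {ffun 'I_D -> 'I_L}) qform (a (wcomp W f)) v.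
    by rewrite -qform_sum sum_words_along_maps // qformZ ler_wpM2l.
  rewrite (bigID (mem inj)) /= in tot.
  have noninj : \sum_(f : {ffun 'I_D -> 'I_L} | f \notin inj) qform (a (wcomp W f)) v <=
      c * ((L ^ D)%:R - (L ^_ D)%:R).
    apply: (@le_trans _ _ (\sum_(f : {ffun 'I_D -> 'I_L} | f \notin inj) c)).
      by apply: ler_sum => f _; exact: cP.
    rewrite sumr_const -[c *+ _]mulr_natr ler_wpM2l // -card_inj.
    rewrite lerBrDr -natrD ler_nat addnC.
    rewrite [leqLHS](cardC (mem inj)) card_ffun !card_ord //.
  by move: tot noninj LP; rewrite mulrC; lra.
have -> : \sum_(W : {ffun 'I_L -> 'I_N}) (\prod_l y (W l)) *: constmx n (B W) =
  (L ^_ D)%:R^-1%:MP *: \sum_(f in inj)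
    \sum_(W : {ffun 'I_L -> 'I_N}) (\prod_l y (W l)) *: constmx n (a (wcomp W f)).
  rewrite exchange_big scaler_sumr /=; apply: eq_bigr => W _.
  by rewrite /B constmxZ constmx_sum scalerA mulrC -scalerA scaler_sumr.
rewrite (eq_bigr (fun=> (\sum_i y i) ^+ (L - D) *:
  \sum_(w : {ffun 'I_D -> 'I_N}) (\prod_k y (w k)) *: constmx n (a w))).
  rewrite sumr_const card_inj -scalerMnr scalerMnl -mpolyCMn -[_ *+ (L ^_ D)]mulr_natr.
  by rewrite mulVf ?gt_eqF // mpolyC1 scale1r.
by move=> f; rewrite inE => /injectiveP f_inj; exact: sum_words_along_injection.
Qed.

End Polya.

(** * Positive definite forms off the origin *)

Section Reznick.
Variables (R : realType) (n : nat).
Local Notation letter := (bool * ('I_n * 'I_n))%type.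
Local Notation N := #|{: letter}|.

Definition letter_form (a : letter) : {mpoly R[n]} :=
  sqnorm_mpoly R n + (-1) ^+ a.1 * ('X_(a.2.1) * 'X_(a.2.2)).

(** With sigma the sign, twice the form is (x_i + sigma x_j)^2 plus the squares of all x_l with l !=
    i plus those of all x_l with l != j. *)
Lemma sos_letter_form a : sos_poly (letter_form a).
Proof.
case: a => s [i j]; rewrite /letter_form /=.
pose S (k : 'I_n) : {mpoly R[n]} := \sum_(l < n | l != k) 'X_l ^+ 2.
have SE k : sqnorm_mpoly R n = 'X_k ^+ 2 + S k by rewrite /sqnorm_mpoly (bigD1 k).
have sosS k : sos_poly (S k) by apply: sos_sum => l _; exact: sos_sqr.
have -> : sqnorm_mpoly R n + (-1) ^+ s * ('X_i * 'X_j) =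
    2^-1 *: (('X_i + (-1) ^+ s * 'X_j) ^+ 2 + S i + S j).
  apply: (@scalerI _ _ 2); first by rewrite pnatr_eq0.
  rewrite scalerA mulfV ?pnatr_eq0 // scale1r scaler_nat mulr2n {1}(SE i) (SE j).
  by case: s; rewrite ?expr1 ?expr0; ring.
apply: sosZ; first by rewrite invr_ge0.
by apply: sosD => //; apply: sosD => //; exact: sos_sqr.
Qed.

Definition lvar (s : bool) (i j : 'I_n) : {mpoly R[N]} := 'X_(enum_rank (s, (i, j))).

Definition lmoment i j : {mpoly R[N]} := 2^-1 *: (lvar false i j - lvar true i j).

Definition lsum : {mpoly R[N]} := \sum_k 'X_k.

Local Notation letter_subst :=
  (comp_mpoly [tuple letter_form (enum_val k) | k < N]).

Lemma letter_substX k : letter_subst 'X_k = letter_form (enum_val k).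
Proof. by rewrite comp_mpolyXU -tnth_nth tnth_mktuple. Qed.

Lemma letter_subst_moment i j : letter_subst (lmoment i j) = 'X_i * 'X_j.
Proof.
rewrite /lmoment linearZ /= raddfB /= !letter_substX !enum_rankK /letter_form /=.
rewrite expr0 expr1 mul1r mulN1r opprD opprK addrACA subrr add0r -mulr2n.
by rewrite -scalerMnr scalerMnl -[_ *+ 2]mulr_natr mulVf ?pnatr_eq0 // scale1r.
Qed.

Definition kappa : R := (2 * n ^ 2)%:R.

Lemma letter_subst_sum : letter_subst lsum = kappa *: sqnorm_mpoly R n.
Proof.
rewrite /lsum raddf_sum /=.
rewrite (eq_bigr (fun k => letter_form (enum_val k))) => [|k _]; last exact: letter_substX.
rewrite -big_enum_val /=.
rewrite (eq_bigr (fun a : letter => letter_form (a.1, a.2))) => [|[]//].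
rewrite -(pair_bigA _ (fun s ij => letter_form (s, ij))) /= big_bool -big_split /=.
rewrite (eq_bigr (fun=> sqnorm_mpoly R n *+ 2)) => [|ij _]; last first.
  by rewrite /letter_form /= expr0 expr1 mul1r mulN1r addrACA addNr addr0 mulr2n.
by rewrite sumr_const card_prod !card_ord -mulrnA /kappa -scaler_nat.
Qed.

(** With X the matrix of the [lmoment i j], the first sum asks for X_ii X_kl = X_ik X_il, minors of
    a rank one matrix. The second term compares the trace with the sum of the letters: after
    substitution their ratio is [kappa], the number of letters. It excludes X = 0, and its factor
    [lsum ^+ 2] brings it to degree 4. *)
Definition relation_form : {mpoly R[N]} :=
  \sum_i \sum_k \sum_l (lmoment i i * lmoment k l - lmoment i k * lmoment i l) ^+ 2
  + (kappa *: \sum_i lmoment i i - lsum) ^+ 2 * lsum ^+ 2.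

Lemma lmoment_homog i j : lmoment i j \is 1.-homog.
Proof. by apply/dhomogZ/rpredB; exact: homogXU. Qed.

Lemma lsum_homog : lsum \is 1.-homog.
Proof. by apply: homog_sum => k _; exact: homogXU. Qed.

Lemma lsumX_homog k : lsum ^+ k \is k.-homog.
Proof. by rewrite -[X in X.-homog]mul1n; apply: dhomogMn; exact: lsum_homog. Qed.

Lemma relation_form_homog : relation_form \is 4.-homog.
Proof.
apply: rpredD; do ?[apply: homog_sum => ? _].
  apply: (@dhomogMn _ _ _ 2); apply: rpredB;
    by apply: (@dhomogM _ _ _ 1 _ 1); exact: lmoment_homog.
apply: (@dhomogM _ _ _ 2 _ 2); apply: (@dhomogMn _ _ _ 1); last exact: lsum_homog.
apply: rpredB; last exact: lsum_homog.
by apply/dhomogZ/homog_sum => i _; exact: lmoment_homog.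
Qed.

Lemma letter_subst_relation : letter_subst relation_form = 0.
Proof.
rewrite /relation_form raddfD /= raddf_sum /= big1 => [|i _].
  rewrite add0r rmorphM rmorphXn /= comp_mpolyB comp_mpolyZ letter_subst_sum.
  rewrite (raddf_sum (comp_mpoly _)) /= (eq_bigr (fun i => 'X_i ^+ 2 : {mpoly R[n]})) => [|i _].
    by rewrite subrr expr0n mul0r.
  by rewrite letter_subst_moment expr2.
rewrite raddf_sum /= big1 // => k _; rewrite raddf_sum /= big1 // => l _.
rewrite rmorphXn /= raddfB /= !rmorphM /= !letter_subst_moment.
by apply/eqP; rewrite sqrf_eq0; apply/eqP; ring.
Qed.

Lemma relation_form_ge0 (y : 'I_N -> R) : 0 <= relation_form.@[y].
Proof.
rewrite /relation_form mevalD addr_ge0 //; last first.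
  by rewrite mevalM !rmorphXn /= mulr_ge0 ?sqr_ge0.
rewrite raddf_sum /= sumr_ge0 // => i _; rewrite raddf_sum /= sumr_ge0 // => k _.
by rewrite raddf_sum /= sumr_ge0 // => l _; rewrite rmorphXn sqr_ge0.
Qed.

(* On the simplex the relations say that the moments form a rank one matrix
   with positive trace, hence come from an actual point. *)
Lemma relation_form_eq0 (y : 'I_N -> R) :
  lsum.@[y] = 1 -> relation_form.@[y] = 0 ->
  exists2 x : 'rV[R]_n, x != 0 &
    forall i j, (lmoment i j).@[y] = x 0 i * x 0 j.
Proof.
move=> s1; set X := fun i j => (lmoment i j).@[y].
have -> : relation_form.@[y] =
    \sum_i \sum_k \sum_l (X i i * X k l - X i k * X i l) ^+ 2
    + (kappa * (\sum_i X i i) - 1) ^+ 2.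
  rewrite /relation_form mevalD mevalM !rmorphXn /= s1 expr1n mulr1.
  rewrite mevalB mevalZ s1; congr (_ + (kappa * _ - 1) ^+ 2); last by rewrite raddf_sum.
  rewrite raddf_sum /=; apply: eq_bigr => i _; rewrite raddf_sum /=; apply: eq_bigr => k _.
  rewrite raddf_sum /=; apply: eq_bigr => l _.
  by rewrite rmorphXn /= mevalB !mevalM.
have S0 : 0 <= \sum_i \sum_k \sum_l (X i i * X k l - X i k * X i l) ^+ 2.
  by do 3!apply: sumr_ge0 => ? _; exact: sqr_ge0.
move=> /eqP; rewrite paddr_eq0 ?sqr_ge0 // => /andP[/eqP Srel].
rewrite sqrf_eq0 subr_eq0 => /eqP tr.
have rel i k l : X i i * X k l = X i k * X i l.
  apply/eqP; rewrite -subr_eq0 -sqrf_eq0; apply/eqP.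
  have sq2 i' k' : 0 <= \sum_l (X i' i' * X k' l - X i' k' * X i' l) ^+ 2.
    by apply: sumr_ge0 => ? _; exact: sqr_ge0.
  have Si : \sum_k' \sum_l' (X i i * X k' l' - X i k' * X i l') ^+ 2 = 0.
    by apply: (psumr_eq0P _ Srel) => // i' _; apply: sumr_ge0 => k' _; exact: sq2.
  have Sk : \sum_l' (X i i * X k l' - X i k * X i l') ^+ 2 = 0.
    by apply: (psumr_eq0P _ Si) => // k' _; exact: sq2.
  by apply: (psumr_eq0P _ Sk) => // l' _; exact: sqr_ge0.
(* Since [kappa] times the trace is 1, some diagonal moment is positive; the minors through it
   determine the point up to sign. *)
have [[i Xi]|no] := pselect (exists i, 0 < X i i); last first.
  have : kappa * \sum_i X i i <= 0.
    rewrite mulr_ge0_le0 ?ler0n // -oppr_ge0 -sumrN sumr_ge0 // => i _.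
    by rewrite oppr_ge0 leNgt; apply/negP => Xi; apply: no; exists i.
  by rewrite tr ler10.
have Xi0 : Num.sqrt (X i i) != 0 by rewrite gt_eqF // sqrtr_gt0.
exists (\row_k (X i k / Num.sqrt (X i i))) => [|k l].
  apply/eqP => /rowP/(_ i); rewrite !mxE => /eqP.
  by rewrite mulf_eq0 invr_eq0 (negPf Xi0) gt_eqF.
rewrite !mxE mulrACA -invfM -expr2 sqr_sqrtr ?ltW // -rel mulrC mulKf //.
by rewrite gt_eqF.
Qed.
(** A word of 2D variables is cut into D pairs, position k with position D + k, and each pair
    becomes a moment. The lift is one function of the polynomial, so that equal entries have equal
    lifts and a symmetric matrix keeps its symmetry. *)
Lemma moment_lift D : exists lift : {mpoly R[n]} -> {mpoly R[N]},
  forall p, p \is (D + D).-homog ->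
  [/\ lift p \is D.-homog, letter_subst (lift p) = p &
    forall y (x : 'rV[R]_n), (forall i j, (lmoment i j).@[y] = x 0 i * x 0 j) ->
      (lift p).@[y] = p.@[x 0]].
Proof.
pose ok p p' := p \is (D + D).-homog -> [/\ p' \is D.-homog,
  letter_subst p' = p & forall y (x : 'rV[R]_n),
  (forall i j, (lmoment i j).@[y] = x 0 i * x 0 j) -> p'.@[y] = p.@[x 0]].
suff H p : exists p', ok p p' by have [f fP] := choice H; exists f.
rewrite /ok; have [|Np] := boolP (p \is (D + D).-homog); last by exists 0.
move=> /homog_word[c ->].
exists (\sum_u c u *: \prod_k lmoment (u (lshift D k)) (u (rshift D k))) => _.
split=> [||y x yx].
- apply: homog_sum => u _; apply: dhomogZ.
  by have := homog_prod_const (fun k => lmoment_homog (u (lshift D k)) (u (rshift D k)));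
    rewrite card_ord mul1n.
- rewrite raddf_sum /=; apply: eq_bigr => u _; rewrite comp_mpolyZ rmorph_prod /=.
  rewrite big_split_ord /= -big_split /=; congr (_ *: _); apply: eq_bigr => k _.
  exact: letter_subst_moment.
rewrite !raddf_sum /=; apply: eq_bigr => u _; rewrite !mevalZ !rmorph_prod /=.
rewrite big_split_ord /= -big_split /=; congr (_ * _); apply: eq_bigr => k _.
by rewrite yx !mevalXU.
Qed.

Theorem matrix_reznick m D (P : 'M[{mpoly R[n]}]_m) : (0 < n)%N ->
  P^T = P -> homog_mx (D + D) P ->
  (forall x : 'rV[R]_n, x != 0 -> posdef (eval_mx P x)) ->
  exists nu, sos_mx (sqnorm_mpoly R n ^+ nu *: P).
Proof.
move=> n0 P_sym P_homog P_pos.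
have [lift liftP] := moment_lift D.
pose P' : 'M[{mpoly R[N]}]_m := \matrix_(i, j) lift (P i j).
pose Z := ([set y : 'rV[R]_N | (forall i, 0 <= y 0 i) /\ \sum_i y 0 i = 1] `*`
           [set v : 'rV[R]_m | sqn v = 1])%classic.
have lsumE (y : 'I_N -> R) : lsum.@[y] = \sum_i y i.
  by rewrite raddf_sum /=; apply: eq_bigr => i _; rewrite mevalXU.
have [|||||lam lam0 [eps eps0 epsP]] := @compact_penalty _ _ Z
    (fun z => qform (eval_mx P' z.1) z.2) (fun z => relation_form.@[z.1 0]).
- by apply: compact_setX; [exact: simplex_compact | exact: sphere_compact].
- by apply: continuous_qform => z; [exact: cvg_fst | exact: cvg_snd].
- by apply: continuous_meval => z; exact: cvg_fst.
- by move=> z; exact: relation_form_ge0.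
- move=> [y v] /= [[y0 y1] v1] h0.
  have [|x x0 yx] := relation_form_eq0 _ h0; first by rewrite lsumE.
  have -> : eval_mx P' y = eval_mx P x.
    by apply/matrixP => i j; rewrite !mxE; have [_ _ lE] := liftP _ (P_homog i j); exact: lE.
  by have /posdef_qform := P_pos x x0; apply; rewrite -sqn_gt0 v1.
(* On the simplex [lsum] is 1, so F is the lifted matrix plus lam times the relations, and its form
   is at least eps on unit vectors. Under the substitution the relations vanish and F becomes (kappa
   |x|^2)^4 P. The powers of [lsum] equalise the degrees. *)
pose F : 'M[{mpoly R[N]}]_m := lsum ^+ 4 *: P' + (lam *: (lsum ^+ D * relation_form))%:M.
have F_homog : homog_mx (4 + D) F.
  apply: homog_mxD.
    apply: (@homog_mxZ _ _ _ 4 D) => //; first exact: lsumX_homog.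
    by move=> i j; rewrite mxE; have [] := liftP _ (P_homog i j).
  apply/homog_mx_scalar/dhomogZ; rewrite addnC; apply: dhomogM.
    exact: lsumX_homog.
  exact: relation_form_homog.
(* The word coefficients too are a function of the polynomial alone, which makes each [a w]
   symmetric. *)
have [word wordP] : exists word : {mpoly R[N]} -> {ffun 'I_(4 + D) -> 'I_N} -> R,
    forall p, p \is (4 + D).-homog -> p = \sum_w word p w *: \prod_i 'X_(w i).
  pose ok (p : {mpoly R[N]}) a := p \is (4 + D).-homog ->
    p = \sum_(w : {ffun 'I_(4 + D) -> 'I_N}) a w *: \prod_i 'X_(w i).
  suff H p : exists a, ok p a by have [f fP] := choice H; exists f.
  have [/homog_word[c pc]|Np] := boolP (p \is (4 + D).-homog); first by exists c.
  by exists (fun=> 0); rewrite /ok (negPf Np).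
pose a w : 'M[R]_m := \matrix_(i, j) word (F i j) w.
have a_sym w : (a w)^T = a w.
  apply/matrixP => i j; rewrite [LHS]mxE !mxE.
  have -> : P j i = P i j by rewrite -{1}P_sym mxE.
  by rewrite eq_sym.
have F_eval (y : 'I_N -> R) : \sum_(w : {ffun 'I_(4 + D) -> 'I_N}) (\prod_k y (w k)) *: a w =
    \matrix_(i, j) (F i j).@[y].
  apply/matrixP => i j; rewrite summxE [RHS]mxE [in RHS](wordP _ (F_homog i j)).
  rewrite raddf_sum /=; apply: eq_bigr => w _; rewrite mevalZ rmorph_prod /= !mxE mulrC.
  by congr (_ * _); apply: eq_bigr => k _; rewrite mevalXU.
have F_subst : \sum_(w : {ffun 'I_(4 + D) -> 'I_N})
    (\prod_k letter_form (enum_val (w k))) *: constmx n (a w) =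
    (kappa *: sqnorm_mpoly R n) ^+ 4 *: P.
  transitivity (\matrix_(i, j) letter_subst (F i j)).
    apply/matrixP => i j; rewrite summxE [RHS]mxE [in RHS](wordP _ (F_homog i j)).
    rewrite (raddf_sum (comp_mpoly _)) /=; apply: eq_bigr => w _.
    rewrite comp_mpolyZ rmorph_prod /= !mxE mulrC mul_mpolyC.
    by congr (_ *: _); apply: eq_bigr => k _; rewrite letter_substX.
  apply/matrixP => i j; rewrite !mxE comp_mpolyD !rmorphM /= rmorphMn /= comp_mpolyZ.
  rewrite rmorphM /= letter_subst_relation mulr0 scaler0 mul0rn addr0.
  by rewrite letter_subst_sum; have [_ -> _] := liftP _ (P_homog i j).
have [|L [B [leL B_sym B_pos BE]]] := matrix_polya a_sym eps0.
  move=> y v y0 y1 v1; rewrite F_eval.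
  have yE : (\row_i y i) 0 = y by apply/funext => i; rewrite mxE.
  have -> : \matrix_(i, j) (F i j).@[y] =
      eval_mx P' (\row_i y i) + (lam * relation_form.@[y])%:M.
    apply/matrixP => i j; rewrite !mxE yE mevalD !mevalM lsumE y1 !mul1r.
    by rewrite mevalMn mevalZ mevalM rmorphXn /= lsumE y1 expr1n mul1r.
  have := epsP (\row_i y i, v); rewrite /= yE qformD qform_scalar v1 mulr1; apply.
  split=> //=; split=> [i|]; first by rewrite mxE.
  by rewrite -[RHS]y1; apply: eq_bigr => i _; rewrite mxE.
have := BE n (fun k => letter_form (enum_val k)); rewrite F_subst.
have -> : \sum_(k < N) letter_form (enum_val k) = kappa *: sqnorm_mpoly R n.
  rewrite -letter_subst_sum /lsum (raddf_sum (comp_mpoly _)).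
  by apply: eq_bigr => k _; rewrite /= letter_substX.
(* The exponent collects the L - (4 + D) factors of Polya's theorem and the four of [lsum ^+ 4]; the
   power of [kappa], nonzero since n > 0, is then divided out. *)
rewrite scalerA -exprD; set nu := (_ + 4)%N => PE; exists nu.
have k0 : kappa ^+ nu != 0.
  by rewrite expf_neq0 // pnatr_eq0 -lt0n muln_gt0 expn_gt0 n0.
have -> : sqnorm_mpoly R n ^+ nu *: P =
    (kappa ^- nu)%:MP *: ((kappa *: sqnorm_mpoly R n) ^+ nu *: P).
  by rewrite exprZn scalerA mul_mpolyC scalerA mulVf // scale1r.
rewrite -PE; apply: sos_mxZ.
  rewrite -[_%:MP]mulr1 mul_mpolyC; apply: sosZ; last exact: sos1.
  by rewrite invr_ge0 exprn_ge0 // ler0n.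
apply: sos_mx_sum => W _; apply: sos_mxZ; last exact: sos_constmx.
by apply: sos_prod => l _; exact: sos_letter_form.
Qed.

End Reznick.

(** * Positivity on a semialgebraic cone *)

Section Putinar.
Variable R : realType.

(** The constant penalty 1 has no zeros, so [compact_penalty] applies to any - f and returns - f +
    lam >= eps. *)
Lemma compact_upper_bound (T : topologicalType) (Z : set T) (f : T -> R) :
  compact Z -> continuous f -> exists2 M : R, 0 < M & forall z, Z z -> f z <= M.
Proof.
move=> cZ cf.
have [||||lam lam0 [eps eps0 H]] := @compact_penalty R T Z (fun z => - f z) (fun=> 1) cZ.
- by move=> z; apply: cvgN; exact: cf.
- by move=> z; exact: cvg_cst.
- by move=> z; exact: ler01.
- by move=> z _ /eqP; rewrite oner_eq0.
exists (lam + 1) => [|z /H]; first by rewrite ltr_wpDl.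
by rewrite mulr1 addrC lerBrDr => h; lra.
Qed.

(** Each of the K + 1 terms s^i, i <= K, is at least s^K, and (1 - s) times their sum is 1 - s^(K+1)
    <= 1. *)
Lemma expr_decay (s : R) K : 0 <= s <= 1 -> (1 - s) * s ^+ K <= K.+1%:R^-1.
Proof.
move=> /andP[s0 s1]; rewrite -[leRHS]mul1r ler_pdivlMr ?ltr0n //.
have := subrX1 s K.+1 => geo.
apply: (@le_trans _ _ ((1 - s) * \sum_(i < K.+1) s ^+ i)).
  rewrite -mulrA ler_wpM2l ?subr_ge0 // mulr_natr -[leLHS]/(s ^+ K *+ K.+1).
  rewrite -[X in _ *+ X]card_ord -sumr_const; apply: ler_sum => i _.
  by apply: ler_wiXn2l => //; rewrite -ltnS.
by rewrite -[1 - s]opprB mulNr -geo opprB lerBlDr lerDl exprn_ge0.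
Qed.

(** Here (t - |t|) / 2 is min(t, 0). For t < 0 the factor (1 - t)^K is at least 1; for t >= 0
    [expr_decay] applies to s = 1 - t. *)
Lemma negative_part_approx (t : R) K : t <= 1 ->
  t * (1 - t) ^+ K <= (t - `|t|) / 2 + K.+1%:R^-1.
Proof.
move=> t1; have [t0|t0] := leP 0 t.
  rewrite ger0_norm // subrr mul0r add0r -{1}(subKr 1 t).
  by apply: expr_decay; rewrite subr_ge0 t1 lerBlDr lerDl.
rewrite ltr0_norm // opprK -mulr2n -[t *+ 2]mulr_natr mulfK ?pnatr_eq0 //.
apply: (@le_trans _ _ t); last by rewrite lerDl invr_ge0 ler0n.
by rewrite ger_nMr // exprn_ege1 // lerBrDr gerDl ltW.
Qed.

Variables (n q : nat) (g : 'I_q -> {mpoly R[n]}) (e : 'I_q -> nat).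
Hypothesis g_homog : forall j, g j \is (e j + e j).-homog.
Local Notation sq := (sqnorm_mpoly R n).

(* The truncated subtraction is harmless: [matrix_putinar] only produces d with
   e j + e j <= d. *)
Definition weighted_sos m d (Q : 'M[{mpoly R[n]}]_m) : Prop :=
  exists S : 'I_q.+1 -> 'M[{mpoly R[n]}]_m,
    [/\ forall j, sos_mx (S j), homog_mx d (S ord0),
        forall j, homog_mx (d - (e j + e j)) (S (lift ord0 j)) &
        Q = S ord0 + \sum_j g j *: S (lift ord0 j)].

Theorem matrix_putinar m D (P : 'M[{mpoly R[n]}]_m) : (0 < n)%N ->
  P^T = P -> homog_mx (D + D) P ->
  (forall x : 'rV[R]_n, basic_semialg g x -> x != 0 -> posdef (eval_mx P x)) ->
  exists nu0, forall nu, (nu0 <= nu)%N ->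
    weighted_sos (D + D + (nu + nu)) (sq ^+ nu *: P).
Proof.
move=> n0 P_sym P_homog P_pos.
have [M MP] : exists M : 'I_q -> R, forall j, 0 < M j /\
    forall x : 'rV[R]_n, sqn x = 1 -> (g j).@[x 0] <= M j.
  suff H j : exists M : R, 0 < M /\ forall x : 'rV[R]_n, sqn x = 1 -> (g j).@[x 0] <= M.
    by have [f fP] := choice H; exists f.
  have [|M M0 MP] := @compact_upper_bound _ _ (fun x : 'rV[R]_n => (g j).@[x 0])
    (@sphere_compact R n); last by exists M; split=> // x; exact: MP.
  by apply: continuous_meval => x; exact: cvg_id.
pose t j (x : 'rV[R]_n) := (g j).@[x 0] / M j.
pose Z := ([set x : 'rV[R]_n | sqn x = 1] `*` [set v : 'rV[R]_m | sqn v = 1])%classic.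
have h_ge0 (x : 'rV[R]_n) j : 0 <= `|t j x| - t j x by rewrite subr_ge0 ler_norm.
have [|||||mu mu0 [eps eps0 epsP]] := @compact_penalty _ _ Z
    (fun z => qform (eval_mx P z.1) z.2) (fun z => \sum_j (`|t j z.1| - t j z.1)).
- by apply: compact_setX; exact: sphere_compact.
- by apply: continuous_qform => z; [exact: cvg_fst | exact: cvg_snd].
- apply: continuous_sum => j _.
  have ct : continuous (fun z : 'rV[R]_n * 'rV[R]_m => t j z.1).
    apply: continuous_mul; last by move=> z; exact: cvg_cst.
    by apply: continuous_meval => z; exact: cvg_fst.
  by move=> z; apply: cvgB; [apply: cvg_norm|]; exact: ct.
- by move=> z; apply: sumr_ge0.
- move=> [x v] /= [x1 v1] h0.
  have xK : basic_semialg g x.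
    move=> j; have [M0 _] := MP j.
    have := psumr_eq0P (fun j _ => h_ge0 x j) h0 (i := j) isT => /eqP.
    by rewrite subr_eq0 eqr_norm_id pmulr_lge0 // invr_gt0.
  have x0 : x != 0 by rewrite -sqn_gt0 x1.
  by have /posdef_qform := P_pos x xK x0; apply; rewrite -sqn_gt0 v1.
(* The penalty mu (|t| - t) is - 2 mu min(t, 0). Replacing min(t, 0) by t (1 - t)^(2k) in all q
   constraints costs at most 2 mu q / (2k + 1), which this k makes smaller than eps. *)
have [k kP] : exists k, 2 * mu * q%:R < eps * (k + k).+1%:R.
  have c0 : 0 <= 2 * mu * q%:R / eps by rewrite divr_ge0 ?mulr_ge0 // ltW.
  have := archi_boundP c0; set b := Num.bound _ => bP.
  exists b; move: bP; rewrite ltr_pdivrMr // => /lt_le_trans; apply.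
  by rewrite mulrC ler_pM2l // ler_nat -addSn leqW ?leq_addr // leq_addl.
(* K is even, so the power of 1 - t_j that [W j] homogenises is a square. As [a] is at least every
   e_j (K + 1), the subtraction in [b j] does not truncate, and g_j W_j has the degree of |x|^(2a)
   P. *)
pose K := (k + k)%N; pose a := (\sum_j e j * K.+1)%N.
have leKa j : (e j * K.+1 <= a)%N by rewrite /a (bigD1 j) //= leq_addr.
pose b j := (a + D - e j * K.+1)%N.
pose W j : {mpoly R[n]} := (2 * mu / M j) *: (sq ^+ b j * (sq ^+ e j - (M j)^-1 *: g j) ^+ K).
have W_sos j : sos_poly (W j).
  apply: sosZ; first by have [/ltW M0 _] := MP j; rewrite divr_ge0 ?mulr_ge0.
  apply: sosM; first by apply: sosX; exact: sos_sqnorm.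
  by rewrite /K exprD -expr2; exact: sos_sqr.
have W_homog j : W j \is (b j + b j + (e j + e j) * K).-homog.
  apply: dhomogZ; apply: dhomogM; first by rewrite addnn; exact: homog_sqnorm.
  apply: dhomogMn; apply: rpredB; first by rewrite addnn; exact: homog_sqnorm.
  by apply: dhomogZ; exact: g_homog.
pose Q : 'M[{mpoly R[n]}]_m := sq ^+ a *: P - \sum_j g j *: (W j)%:M.
have Q_homog : homog_mx ((a + D) + (a + D)) Q.
  apply: homog_mxB.
    by apply: (homog_mxZ (homog_sqnorm R n a) P_homog); rewrite -addnn; lia.
  apply: homog_mx_sum => j _.
  apply: (homog_mxZ (g_homog j) (homog_mx_scalar (W_homog j))).
  by have := leKa j; rewrite /b; lia.
have Q_sym : Q^T = Q.
  rewrite linearB linearZ /= P_sym linear_sum /=; congr (_ - _).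
  by apply: eq_bigr => j _; rewrite linearZ /= tr_scalar_mx.
have Q_pos (x : 'rV[R]_n) : x != 0 -> posdef (eval_mx Q x).
  move=> /unit_scaling[c c0 cx1]; apply: posdef_sqnP => v v1.
  have := eval_mx_homog x c Q_homog => /(congr1 (fun A => qform A v)).
  rewrite qformZ => cE; rewrite -(pmulr_rgt0 _ (exprn_gt0 (a + D + (a + D)) c0)) -cE.
  move: (c *: x) cx1 => {}x x1 {c c0 cE}.
  have := epsP (x, v) (conj x1 v1) => /= h.
  rewrite eval_mxB qformB eval_mxZ qformZ rmorphXn /= sqnorm_eval x1 expr1n mul1r.
  rewrite eval_mx_sum qform_sum.
  have -> : \sum_j qform (eval_mx (g j *: (W j)%:M) x) v =
      2 * mu * \sum_j t j x * (1 - t j x) ^+ K.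
    rewrite mulr_sumr; apply: eq_bigr => j _.
    rewrite eval_mxZ qformZ eval_mx_scalar qform_scalar v1 mulr1 mevalZ mevalM.
    rewrite !rmorphXn /= mevalB mevalZ rmorphXn /= sqnorm_eval x1 !expr1n mul1r.
    by rewrite /t [(M j)^-1 * _]mulrC; move: (_ ^+ K) => z; ring.
  have : \sum_j t j x * (1 - t j x) ^+ K <=
      \sum_j ((t j x - `|t j x|) / 2 + K.+1%:R^-1).
    apply: ler_sum => j _; apply: negative_part_approx.
    by have [M0 /(_ x x1)] := MP j; rewrite /t ler_pdivrMr // mul1r.
  rewrite big_split /= sumr_const card_ord -mulr_suml => hs.
  have : 2 * mu * (K.+1%:R^-1 *+ q) < eps.
    by rewrite -[_ *+ q]mulr_natl mulrA ltr_pdivrMr ?ltr0n.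
  have := ler_wpM2l mu0 hs; move: h.
  have -> : \sum_j (`|t j x| - t j x) = - \sum_j (t j x - `|t j x|).
    by rewrite -sumrN; apply: eq_bigr => j _; rewrite opprB.
  move: (_ *+ q) (\sum_j (t j x - _)) (\sum_j t j x * _) (qform _ _) => c s T A.
  by move=> h1 h2 h3; lra.
have [nu1 nu1P] := matrix_reznick n0 Q_sym Q_homog Q_pos.
exists (nu1 + a)%N => nu le_nu.
(* The surplus dl is absorbed by multiplying every term by a power of |x|^2, itself a sum of
   squares. *)
have [dl ->] : exists dl, nu = (dl + nu1 + a)%N by exists (nu - (nu1 + a))%N; lia.
exists (fun j => if unlift ord0 j is Some j' then (sq ^+ (dl + nu1) * W j')%:M
                 else sq ^+ dl *: (sq ^+ nu1 *: Q)).
split=> [j||j|].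
- case: (unlift _ _) => [j'|].
    by apply: sos_scalar_mx; apply: sosM => //; apply: sosX; exact: sos_sqnorm.
  by apply: sos_mxZ => //; apply: sosX; exact: sos_sqnorm.
- rewrite unlift_none scalerA -exprD.
  by apply: (homog_mxZ (homog_sqnorm R n _) Q_homog); rewrite -addnn; lia.
- rewrite liftK; apply: homog_mx_scalar.
  apply: (homogMd (homog_sqnorm R n _) (W_homog j)).
  by have := leKa j; rewrite /b -addnn; lia.
rewrite unlift_none; under eq_bigr => j _ do rewrite liftK.
rewrite scalerA -exprD /Q scalerBr scalerA -exprD scaler_sumr.
rewrite [X in _ + X](eq_bigr (fun j => sq ^+ (dl + nu1) *: (g j *: (W j)%:M))) ?subrK // => j _.
by rewrite scalar_mxM mul_scalar_mx !scalerA mulrC.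
Qed.

End Putinar.

(** * Blocks indexed by cliques *)

Section CliqueMatrices.
Variables (m : nat) (A : comNzRingType).
Implicit Types (C : {set 'I_m}).

Lemma clique_mx_mul_tr C : clique_mx A C *m (clique_mx A C)^T = 1%:M.
Proof.
apply/matrixP => i j; rewrite !mxE (bigD1 (enum_val i)) //= !mxE eqxx mul1r.
rewrite big1 ?addr0 => [|k /negPf ki]; last by rewrite !mxE eq_sym ki mul0r.
by rewrite (inj_eq enum_val_inj) eq_sym.
Qed.

Lemma clique_mx_sub C (M : 'M[A]_m) :
  clique_mx A C *m M *m (clique_mx A C)^T =
  \matrix_(i, j) M (enum_val i) (enum_val j).
Proof.
apply/matrixP => i j; rewrite !mxE (bigD1 (enum_val j)) //= !mxE eqxx mulr1.
rewrite (bigD1 (enum_val i)) //= !mxE eqxx mul1r.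
rewrite [X in _ + X + _]big1 => [|k /negPf ki]; last by rewrite !mxE eq_sym ki mul0r.
rewrite addr0 big1 ?addr0 // => k /negPf kj.
by rewrite !mxE [enum_val j == k]eq_sym kj mulr0.
Qed.

(** E^T E is the diagonal projection onto the coordinates in C, which fixes any matrix supported on
    C x C from both sides. *)
Lemma clique_mx_expand C (M : 'M[A]_m) :
  (forall i j, M i j != 0 -> (i \in C) && (j \in C)) ->
  M = (clique_mx A C)^T *m (clique_mx A C *m M *m (clique_mx A C)^T) *m clique_mx A C.
Proof.
move=> MC; pose p (i : 'I_m) : A := (i \in C)%:R.
have pE : (clique_mx A C)^T *m clique_mx A C = diag_mx (\row_i p i).
  apply/matrixP => i j; rewrite !mxE /p; have [iC|iC] := boolP (i \in C).
    rewrite (bigD1 (enum_rank_in iC i)) //= !mxE enum_rankK_in // eqxx mul1r.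
    rewrite big1 ?addr0 // => k ki; rewrite !mxE.
    case: eqP => [kE|]; last by rewrite mul0r.
    by case/eqP: ki; apply: enum_val_inj; rewrite enum_rankK_in.
  rewrite mul0rn big1 // => k _; rewrite !mxE.
  by case: eqP => [kE|_]; [rewrite -kE enum_valP in iC | rewrite mul0r].
rewrite !mulmxA pE -!mulmxA pE mulmxA mul_diag_mx mul_mx_diag.
apply/matrixP => i j; rewrite !mxE /p; have [->|/MC /andP[-> ->]] := eqVneq (M i j) 0.
  by rewrite mulr0 mul0r.
by rewrite mul1r mulr1.
Qed.

End CliqueMatrices.

Lemma constmx_clique (R : realType) n m (C : {set 'I_m}) :
  constmx n (clique_mx R C) = clique_mx {mpoly R[n]} C.
Proof. by apply/matrixP => i j; rewrite !mxE rmorph_nat. Qed.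

Section WeightedSums.
Variables (R : realType) (n q : nat) (g : 'I_q -> {mpoly R[n]}) (e : 'I_q -> nat).
Local Notation wsos := (weighted_sos g e).

Lemma weighted_sos0 m d : wsos d (0 : 'M_m).
Proof.
have h0 k : homog_mx k (0 : 'M[{mpoly R[n]}]_m) by move=> i j; rewrite mxE dhomog0.
exists (fun=> 0); split=> // [j|]; first exact: sos_mx0.
by rewrite big1 ?addr0 // => j _; rewrite scaler0.
Qed.

Lemma weighted_sosD m d (P Q : 'M_m) : wsos d P -> wsos d Q -> wsos d (P + Q).
Proof.
move=> [S [S1 S2 S3 ->]] [T [T1 T2 T3 ->]]; exists (fun j => S j + T j); split.
- by move=> j; exact: sos_mxD.
- exact: homog_mxD.
- by move=> j; exact: homog_mxD.
rewrite addrACA -big_split /=; congr (_ + _); apply: eq_bigr => j _.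
by rewrite scalerDr.
Qed.

Lemma weighted_sos_congr m k d (P : 'M_m) (F : 'M[R]_(m, k)) :
  wsos d P -> wsos d ((constmx n F)^T *m P *m constmx n F).
Proof.
move=> [S [S1 S2 S3 ->]]; exists (fun j => (constmx n F)^T *m S j *m constmx n F); split.
- by move=> j; exact: sos_mx_congr.
- exact: homog_mx_congr.
- by move=> j; exact: homog_mx_congr.
rewrite mulmxDr mulmxDl mulmx_sumr mulmx_suml; congr (_ + _); apply: eq_bigr => j _.
by rewrite -scalemxAr -scalemxAl.
Qed.

Variables (m t : nat) (C : 'I_t -> {set 'I_m}).

Definition clique_sos d (P : 'M[{mpoly R[n]}]_m) : Prop :=
  exists Q : forall k, 'M[{mpoly R[n]}]_#|C k|,
    (forall k, wsos d (Q k)) /\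
    P = \sum_k (clique_mx {mpoly R[n]} (C k))^T *m Q k *m clique_mx {mpoly R[n]} (C k).

Lemma clique_sos0 d : clique_sos d 0.
Proof.
exists (fun=> 0); split=> [k|]; first exact: weighted_sos0.
by rewrite big1 // => k _; rewrite mulmx0 mul0mx.
Qed.

Lemma clique_sosD d P Q : clique_sos d P -> clique_sos d Q -> clique_sos d (P + Q).
Proof.
move=> [S [S1 ->]] [T [T1 ->]]; exists (fun k => S k + T k); split=> [k|].
  exact: weighted_sosD.
by rewrite -big_split /=; apply: eq_bigr => k _; rewrite mulmxDr mulmxDl.
Qed.

Local Notation E := (clique_mx {mpoly R[n]}).

(** The cliques met during elimination need not be maximal: a block on A is padded with zeros to a
    block on [C k], and the two congruences involved preserve weighted sums of squares. *)
Lemma clique_sos_single d (A : {set 'I_m}) k (S : 'M_#|A|) :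
  A \subset C k -> wsos d S ->
  clique_sos d ((clique_mx {mpoly R[n]} A)^T *m S *m clique_mx {mpoly R[n]} A).
Proof.
move=> AC wS; set M := _ *m S *m _.
exists (fun k' => if k' == k then E (C k') *m M *m (E (C k'))^T else 0); split=> [k'|].
  case: eqP => // _; last exact: weighted_sos0.
  rewrite -{1}[E (C k')]trmxK /M -!constmx_clique.
  have -> : (constmx n (clique_mx R (C k')))^T = constmx n (clique_mx R (C k'))^T.
    by rewrite /constmx map_trmx.
  by do 2!apply: weighted_sos_congr.
rewrite (bigD1 k) //= eqxx big1 ?addr0 => [|k' /negPf ->]; last by rewrite mulmx0 mul0mx.
apply: clique_mx_expand => i j; apply: contraNT; rewrite negb_and => ijC.
rewrite /M mxE; apply/eqP; case/orP: ijC => /negP nC; last first.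
  apply: big1 => l _; rewrite [E A _ _]mxE; case: eqP => [lj|]; last by rewrite mulr0.
  by case: nC; rewrite -lj; apply: (fintype.subsetP AC); exact: enum_valP.
apply: big1 => l _; rewrite mxE big1 ?mul0r // => l' _.
rewrite [_^T i l']mxE [E A _ _]mxE; case: eqP => [lj|]; last by rewrite mul0r.
by case: nC; rewrite -lj; apply: (fintype.subsetP AC); exact: enum_valP.
Qed.

End WeightedSums.

(** * Splitting off a pivot *)

Section Pivot.
Variables (A : comNzRingType) (m : nat) (s : 'I_m) (N : {set 'I_m}).

(** With d the unit vector at s, this is a d d^T + w (b d^T + d b^T) + u b b^T + c I_N, where I_N
    projects onto N. For c = 0 and u = w^2 / a it would be the rank one matrix (a d + w b)(a d + w
    b)^T / a of exact elimination. *)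
Definition pivot_mx (a w u c : A) (b : 'I_m -> A) : 'M[A]_m :=
  \matrix_(i, j) (a * ((i == s)%:R * (j == s)%:R) + w * (b i * (j == s)%:R + (i == s)%:R * b j)
                  + u * (b i * b j) + c * ((i == j) && (i \in N))%:R).

Lemma pivot_mx_sym a w u c b : (pivot_mx a w u c b)^T = pivot_mx a w u c b.
Proof.
apply/matrixP => i j; rewrite !mxE; have -> : (j == i) && (j \in N) = (i == j) && (i \in N).
  by rewrite eq_sym; case: eqP => [->|].
by ring.
Qed.

End Pivot.

Section QuadraticPivot.
Variables (R : realType) (m : nat).
Implicit Types (M : 'M[R]_m) (v : 'rV[R]_m).

Lemma qform_rank1 (f h : 'I_m -> R) v :
  qform (\matrix_(i, j) (f i * h j)) v = (\sum_i f i * v 0 i) * (\sum_i h i * v 0 i).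
Proof.
rewrite qformE mulr_sumr; apply: eq_bigr => j _; rewrite mulr_suml.
by apply: eq_bigr => i _; rewrite mxE; ring.
Qed.

Lemma sum_delta s v : \sum_i (i == s)%:R * v 0 i = v 0 s.
Proof.
rewrite (bigD1 s) //= eqxx mul1r big1 ?addr0 // => i /negPf ->.
by rewrite mul0r.
Qed.

Lemma qform_pivot s (N : {set 'I_m}) (a w u c : R) (b : 'I_m -> R) v :
  let beta := \sum_i b i * v 0 i in
  qform (pivot_mx s N a w u c b) v =
  a * v 0 s ^+ 2 + 2 * w * v 0 s * beta + u * beta ^+ 2 + c * \sum_(i in N) v 0 i ^+ 2.
Proof.
move=> beta; pose d i : R := (i == s)%:R.
have -> : pivot_mx s N a w u c b = a *: (\matrix_(i, j) (d i * d j)) +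
    w *: (\matrix_(i, j) (b i * d j) + \matrix_(i, j) (d i * b j)) +
    u *: (\matrix_(i, j) (b i * b j)) + c *: diag_mx (\row_i (i \in N)%:R).
  apply/matrixP => i j; rewrite !mxE; congr (_ + c * _).
  by case: eqP => [->|_]; rewrite ?mulr1n ?mulr0n.
rewrite !qformD !qformZ qformD !qform_rank1 sum_delta -/beta.
have -> : qform (diag_mx (\row_i (i \in N)%:R)) v = \sum_(i in N) v 0 i ^+ 2.
  rewrite /qform mul_mx_diag mxE [RHS]big_mkcond; apply: eq_bigr => i _.
  by rewrite !mxE; case: (i \in N); rewrite ?mulr1 ?expr2 ?mulr0 ?mul0r.
by ring.
Qed.

Lemma qform_shift M s v c : M^T = M ->
  qform M (v + c *: delta_mx 0 s) =
  qform M v + 2 * c * (\sum_i M i s * v 0 i) + c ^+ 2 * M s s.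
Proof.
move=> M_sym; have mxD (X Y : 'M[R]_1) : (X + Y) 0 0 = X 0 0 + Y 0 0 by rewrite mxE.
have tr : (c *: delta_mx 0 s : 'rV[R]_m)^T = c *: delta_mx s 0 by rewrite linearZ /= trmx_delta.
rewrite /qform linearD /= tr !mulmxDl !mulmxDr !mxD.
have -> : (v *m M *m (c *: delta_mx s 0 : 'cV[R]_m)) 0 0 = c * \sum_i M i s * v 0 i.
  rewrite -scalemxAr mxE -colE !mxE; congr (_ * _).
  by apply: eq_bigr => i _; rewrite mulrC.
have -> : ((c *: delta_mx 0 s : 'rV[R]_m) *m M *m v^T) 0 0 = c * \sum_i M i s * v 0 i.
  rewrite -!scalemxAl mxE -rowE !mxE; congr (_ * _).
  by apply: eq_bigr => i _; rewrite !mxE -{1}M_sym mxE.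
have -> : ((c *: delta_mx 0 s : 'rV[R]_m) *m M *m (c *: delta_mx s 0 : 'cV[R]_m)) 0 0 =
    c ^+ 2 * M s s.
  by rewrite -!scalemxAl -scalemxAr -rowE -colE !mxE; ring.
by ring.
Qed.

End QuadraticPivot.

Section Elimination.
Variables (R : realType) (n q : nat) (g : 'I_q -> {mpoly R[n]}) (e : 'I_q -> nat).
Hypothesis g_homog : forall j, g j \is (e j + e j).-homog.
Variable m : nat.
Local Notation sq := (sqnorm_mpoly R n).

Definition supported (U : {set 'I_m}) (v : 'rV[R]_m) : Prop :=
  forall i, i \notin U -> v 0 i = 0.

Definition posdef_on (U : {set 'I_m}) (M : 'M[{mpoly R[n]}]_m) : Prop :=
  forall x : 'rV[R]_n, basic_semialg g x -> x != 0 ->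
  forall v : 'rV[R]_m, v != 0 -> supported U v -> 0 < qform (eval_mx M x) v.

Lemma basic_semialg_scale (x : 'rV[R]_n) c :
  0 < c -> basic_semialg g x -> basic_semialg g (c *: x).
Proof.
move=> c0 xK j; rewrite (homog_scale _ _ (g_homog j)) mulr_ge0 //.
by rewrite exprn_ge0 ?ltW.
Qed.

Lemma posdef_on_sphere U d (M : 'M[{mpoly R[n]}]_m) : homog_mx d M ->
  (forall x : 'rV[R]_n, basic_semialg g x -> sqn x = 1 ->
   forall v : 'rV[R]_m, v != 0 -> supported U v -> 0 < qform (eval_mx M x) v) ->
  posdef_on U M.
Proof.
move=> M_homog H x xK /unit_scaling[c c0 cx1] v v0 vU.
have := H _ (basic_semialg_scale c0 xK) cx1 v v0 vU.
by rewrite (eval_mx_homog _ _ M_homog) qformZ pmulr_rgt0 // exprn_gt0.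
Qed.

(** Both the cone and the support condition are encoded in the penalty: negative parts of the g_j
    and squares of the coordinates outside U. Compactness is then used on the full product of two
    spheres. *)
Lemma posdef_on_uniform U (P : 'M[{mpoly R[n]}]_m) : posdef_on U P ->
  exists2 p : R, 0 < p & forall x : 'rV[R]_n, basic_semialg g x -> sqn x = 1 ->
    forall v, supported U v -> p * sqn v <= qform (eval_mx P x) v.
Proof.
move=> P_pos.
pose Z := ([set x : 'rV[R]_n | sqn x = 1] `*` [set v : 'rV[R]_m | sqn v = 1])%classic.
pose h (z : 'rV[R]_n * 'rV[R]_m) : R := \sum_j (`|(g j).@[z.1 0]| - (g j).@[z.1 0]) +
  \sum_(i | i \notin U) z.2 0 i ^+ 2.
have h1_ge0 (x : 'rV[R]_n) j : 0 <= `|(g j).@[x 0]| - (g j).@[x 0].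
  by rewrite subr_ge0 ler_norm.
have h1s (x : 'rV[R]_n) : 0 <= \sum_j (`|(g j).@[x 0]| - (g j).@[x 0]) by apply: sumr_ge0.
have h2s (v : 'rV[R]_m) : 0 <= \sum_(i | i \notin U) v 0 i ^+ 2.
  by apply: sumr_ge0 => i _; exact: sqr_ge0.
have [|||||lam lam0 [p p0 pP]] := @compact_penalty _ _ Z
    (fun z => qform (eval_mx P z.1) z.2) h.
- by apply: compact_setX; exact: sphere_compact.
- by apply: continuous_qform => z; [exact: cvg_fst | exact: cvg_snd].
- apply: continuous_add; apply: continuous_sum => j _.
    have cg : continuous (fun z : 'rV[R]_n * 'rV[R]_m => (g j).@[z.1 0]).
      by apply: continuous_meval => z; exact: cvg_fst.
    by move=> z; apply: cvgB; [apply: cvg_norm|]; exact: cg.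
  by apply/continuous_exp/continuous_coord => z; exact: cvg_snd.
- by move=> z; exact: addr_ge0.
- move=> [x v] /= [x1 v1] /eqP; rewrite /h /= paddr_eq0 // => /andP[/eqP hx /eqP hv].
  apply: P_pos; [|by rewrite -sqn_gt0 x1|by rewrite -sqn_gt0 v1|] => [j|i iU].
    have := psumr_eq0P (fun j _ => h1_ge0 x j) hx (i := j) isT => /eqP.
    by rewrite subr_eq0 eqr_norm_id.
  apply/eqP; rewrite -sqrf_eq0; apply/eqP.
  by apply: (psumr_eq0P _ hv) => // k _; exact: sqr_ge0.
exists p => // x xK x1 v vU; have [->|v0] := eqVneq v 0.
  have /eqP -> : sqn (0 : 'rV[R]_m) == 0 by rewrite sqn_eq0.
  by rewrite mulr0 /qform !mul0mx mxE.
have [c c0 cv1] := unit_scaling v0.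
have := pP (x, c *: v) (conj x1 cv1) => /=.
have -> : h (x, c *: v) = 0.
  rewrite /h /= !big1 ?addr0 // => [i /vU vi|j _]; first by rewrite mxE vi mulr0 expr0n.
  by rewrite ger0_norm ?subrr //; exact: xK.
rewrite mulr0 addr0 qform_scale; move: cv1; rewrite sqnZ => cv1 h1.
have c2 : 0 < c ^+ 2 by rewrite exprn_gt0.
by rewrite -(ler_pM2l c2) mulrCA cv1 mulr1.
Qed.

Lemma homog_natr d (p : {mpoly R[n]}) k : p \is d.-homog -> p * k%:R \is d.-homog.
Proof. by move=> hp; rewrite mulr_natr rpredMn. Qed.

Lemma sqn_bound_linear (b : 'I_m -> {mpoly R[n]}) :
  exists2 M : R, 0 < M & forall (x : 'rV[R]_n) (v : 'rV[R]_m), sqn x = 1 ->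
    (\sum_i (b i).@[x 0] * v 0 i) ^+ 2 <= M * sqn v.
Proof.
pose Z := ([set x : 'rV[R]_n | sqn x = 1] `*` [set v : 'rV[R]_m | sqn v = 1])%classic.
have [||M M0 MP] := @compact_upper_bound R _ Z
    (fun z => (\sum_i (b i).@[z.1 0] * z.2 0 i) ^+ 2).
- by apply: compact_setX; exact: sphere_compact.
- apply/continuous_exp/continuous_sum => i _; apply: continuous_mul.
    by apply: continuous_meval => z; exact: cvg_fst.
  by apply: continuous_coord => z; exact: cvg_snd.
exists M => // x v x1; have [->|v0] := eqVneq v 0.
  rewrite big1 => [|i _]; last by rewrite mxE mulr0.
  by rewrite expr0n mulr_ge0 ?sqn_ge0 // ltW.
have [c c0 cv1] := unit_scaling v0.
have := MP (x, c *: v) (conj x1 cv1) => /=.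
rewrite (eq_bigr (fun i => c * ((b i).@[x 0] * v 0 i))) => [|i _]; last by rewrite mxE; ring.
rewrite -mulr_sumr exprMn; move: cv1; rewrite sqnZ => cv1 h.
have c2 : 0 < c ^+ 2 by rewrite exprn_gt0.
by rewrite -(ler_pM2l c2) [leRHS]mulrCA cv1 mulr1.
Qed.

(* With a the pivot and b its column, u is a truncated geometric series for 1/a,
   so that the clique block carries slightly more than the Schur complement term
   b b^T / a needs, while the remainder keeps half of the definiteness of P. *)
Lemma pivot_split D (U : {set 'I_m}) (P : 'M[{mpoly R[n]}]_m) (s : 'I_m) :
  let N := [set i | (i != s) && (P i s != 0)] in
  P^T = P -> homog_mx (D + D) P -> s \in U -> posdef_on U P ->
  exists (a0 : nat) (Q P' : 'M[{mpoly R[n]}]_m),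
    [/\ sq ^+ a0 *: P = Q + P',
        [/\ Q^T = Q, homog_mx ((D + a0) + (D + a0)) Q, posdef_on (s |: N) Q &
            forall i j, Q i j != 0 -> (i \in s |: N) && (j \in s |: N)] &
        [/\ P'^T = P', homog_mx ((D + a0) + (D + a0)) P', posdef_on (U :\ s) P' &
            forall i j, P' i j != 0 ->
              [/\ i != s, j != s & (P i j != 0) \/ (i \in N) && (j \in N)]]].
Proof.
move=> N P_sym P_homog sU P_pos.
have [p p0 pP] := posdef_on_uniform P_pos.
pose b i := if i == s then 0 else P i s.
have bN i : i \notin N -> b i = 0.
  by rewrite /b inE negb_and; case: eqP => //= _; rewrite negbK => /eqP.
have b_homog i : b i \is (D + D).-homog.
  by rewrite /b; case: eqP => // _; exact: dhomog0.
have [Mb Mb0 MbP] := sqn_bound_linear b.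
have [|M1 M10 M1P] := @compact_upper_bound R _ _ (fun x : 'rV[R]_n => (P s s).@[x 0])
    (@sphere_compact R n).
  by apply: continuous_meval => x; exact: cvg_id.
(* M bounds [P s s] on the unit sphere, so that r = 1 - P_ss / M lies in [0, 1] at unit vectors of
   the cone. *)
pose M := M1 + p; have M0 : 0 < M by rewrite addr_gt0.
pose eps := p / 2; have eps0 : 0 < eps by rewrite divr_gt0.
(* The series cut after r^k leaves the error rho = r^(k+1). [expr_decay] gives rho <= M / (p (k +
   2)), and k is such that rho Mb < p eps follows. *)
have [k kP] : exists k, Mb * M < p * (p * eps) * k%:R.
  have pe0 : 0 < p * (p * eps) by rewrite mulr_gt0 // mulr_gt0.
  have c0 : 0 <= Mb * M / (p * (p * eps))
    by apply: divr_ge0; [apply: mulr_ge0; exact: ltW | exact: ltW].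
  have := archi_boundP c0; set k := Num.bound _ => bP.
  by exists k; move: bP; rewrite ltr_pdivrMr // [ltRHS]mulrC.
(* [rr] and [uu] homogenise r and (1 + r + ... + r^k) / M, so on the unit sphere uu P_ss = 1 -
   r^(k+1). The degree 2Dk + 4D of u b b^T must be 2 (D + a0), which dictates [a0]. *)
pose rr := sq ^+ D - M^-1 *: P s s.
pose uu := M^-1 *: \sum_(i < k.+1) rr ^+ i * sq ^+ (D * (k - i)).
pose a0 := (D * k.+1)%N.
pose Q := pivot_mx s N (sq ^+ a0 * P s s) (sq ^+ a0) uu (eps *: sq ^+ (D + a0)) b.
have uu_homog : uu \is ((D + D) * k).-homog.
  apply/dhomogZ/homog_sum => i _.
  have rr_homog : rr \is (D + D).-homog.
    by apply: rpredB; [rewrite addnn; exact: homog_sqnorm | apply/dhomogZ/P_homog].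
  apply: (homogMd (dhomogMn i rr_homog) (homog_sqnorm R n _)).
  by have := ltn_ord i; rewrite -addnn; nia.
have Q_homog : homog_mx ((D + a0) + (D + a0)) Q.
  move=> i j; rewrite mxE; apply: rpredD; [apply: rpredD; [apply: rpredD|]|].
  - rewrite -natrM; apply/homog_natr/(homogMd (homog_sqnorm R n _) (P_homog s s)).
    by rewrite -addnn; lia.
  - apply: (homogMd (homog_sqnorm R n a0) (e := D + D)); last by rewrite -addnn; lia.
    by apply: rpredD; [|rewrite mulrC]; exact: homog_natr.
  - apply: (homogMd uu_homog (dhomogM (b_homog i) (b_homog j))).
    by rewrite /a0; lia.
  by apply/homog_natr/dhomogZ; rewrite addnn; exact: homog_sqnorm.
pose P' := sq ^+ a0 *: P - Q.
have P'_homog : homog_mx ((D + a0) + (D + a0)) P'.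
  apply: homog_mxB => //.
  by apply: (homog_mxZ (homog_sqnorm R n a0) P_homog); rewrite -addnn; lia.
have Q_eval (x : 'rV[R]_n) : sqn x = 1 -> eval_mx Q x =
    pivot_mx s N (P s s).@[x 0] 1 uu.@[x 0] eps (fun i => (b i).@[x 0]).
  move=> x1; apply/matrixP => i j; rewrite !mxE !mevalD !mevalM !mevalD !mevalM.
  rewrite (mevalZ _ eps) !rmorph_nat !rmorphXn /= sqnorm_eval x1 !expr1n !mul1r mulr1.
  by [].
have a_ge (x : 'rV[R]_n) : basic_semialg g x -> sqn x = 1 -> p <= (P s s).@[x 0].
  move=> xK x1; have dU : supported U (delta_mx 0 s : 'rV[R]_m).
    by move=> i; rewrite mxE eqxx; case: eqP => // -> /negP.
  have := pP x xK x1 _ dU.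
  have -> : sqn (delta_mx 0 s : 'rV[R]_m) = 1.
    rewrite /sqn (bigD1 s) //= mxE !eqxx expr1n big1 ?addr0 // => i /negPf si.
    by rewrite mxE si andbF expr0n.
  by rewrite mulr1 /qform trmx_delta -rowE -colE !mxE.
have u_bound (x : 'rV[R]_n) : basic_semialg g x -> sqn x = 1 ->
   exists rho, [/\ uu.@[x 0] * (P s s).@[x 0] = 1 - rho, 0 <= rho & rho * Mb < p * eps].
  move=> xK x1; have := a_ge x xK x1; have := M1P x x1.
  set a := (P s s).@[_] => aM ap; pose r := 1 - a / M.
  have aM0 : 0 < a / M by rewrite divr_gt0 // (lt_le_trans p0).
  have r01 : 0 <= r <= 1.
    rewrite /r subr_ge0 ler_pdivrMr // mul1r lerBlDr lerDl (ltW aM0) andbT.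
    by rewrite (le_trans aM) // lerDl ltW.
  exists (r ^+ k.+1); split; last 2 first.
  - by rewrite exprn_ge0 //; case/andP: r01.
  - have := expr_decay k.+1 r01; rewrite {1}/r subKr.
    have : 0 <= r ^+ k.+1 by rewrite exprn_ge0 //; case/andP: r01.
    move: (r ^+ k.+1) => rho rho0.
    rewrite -[leRHS]mul1r ler_pdivlMr ?ltr0n // => h.
    have {}h : a * (rho * k.+2%:R) <= M.
      by move: h; rewrite -mulrA mulrAC ler_pdivrMr // mul1r.
    have {}h : p * (rho * k.+2%:R) <= M.
      by apply: le_trans h; rewrite ler_wpM2r // mulr_ge0.
    have h2 : Mb * (p * (rho * k.+2%:R)) <= Mb * M by rewrite ler_wpM2l // ltW.
    have h3 : p * (p * eps) * k%:R <= p * (p * eps) * k.+2%:R.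
      apply: ler_wpM2l; first by apply/ltW/mulr_gt0 => //; exact: mulr_gt0.
      by rewrite ler_nat -addn2 leq_addr.
    have pk : 0 < p * k.+2%:R by rewrite mulr_gt0 // ltr0n.
    rewrite -(ltr_pM2l pk).
    have -> : p * k.+2%:R * (rho * Mb) = Mb * (p * (rho * k.+2%:R)) by ring.
    have -> : p * k.+2%:R * (p * eps) = p * (p * eps) * k.+2%:R by ring.
    exact: le_lt_trans h2 (lt_le_trans kP h3).
  rewrite /uu mevalZ raddf_sum /=.
  rewrite (eq_bigr (fun i : 'I_k.+1 => r ^+ i)) => [|i _].
    have := subrX1 r k.+1; rewrite /r => geo.
    have -> : 1 - (1 - a / M) ^+ k.+1 = - ((1 - a / M) ^+ k.+1 - 1) by rewrite opprB.
    by rewrite geo; move: (\sum_(i < k.+1) _) => S; ring.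
  rewrite mevalM !rmorphXn /= mevalB mevalZ rmorphXn /= sqnorm_eval x1 !expr1n mulr1.
  by rewrite /r mulrC.
have beta_bound (x : 'rV[R]_n) (v : 'rV[R]_m) : sqn x = 1 ->
    (\sum_i (b i).@[x 0] * v 0 i) ^+ 2 <= Mb * \sum_(i in N) v 0 i ^+ 2.
  move=> x1; have := MbP x (\row_i (if i \in N then v 0 i else 0)) x1.
  rewrite /sqn (eq_bigr (fun i => (b i).@[x 0] * v 0 i)) => [|i _].
    move=> /le_trans; apply; rewrite ler_wpM2l ?(ltW Mb0) //.
    rewrite [leRHS]big_mkcond; apply: ler_sum => i _.
    by rewrite mxE; case: ifP => // _; rewrite expr0n.
  by rewrite mxE; case: ifPn => // /bN ->; rewrite meval0 !mul0r.
exists a0, Q, P'; split; first by rewrite /P' addrC subrK.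
- split=> // [||i j].
  + exact: pivot_mx_sym.
  + apply: (posdef_on_sphere Q_homog) => x xK x1 v v0 vU.
    rewrite (Q_eval _ x1) qform_pivot.
    have := a_ge x xK x1; have [rho []] := u_bound x xK x1; have := beta_bound x v x1.
    have N2_ge0 : 0 <= \sum_(i in N) v 0 i ^+ 2 by apply: sumr_ge0 => i _; exact: sqr_ge0.
    have vsN : v 0 s != 0 \/ 0 < \sum_(i in N) v 0 i ^+ 2.
      have [vs|] := eqVneq (v 0 s) 0; [right | by left].
      rewrite lt_neqAle N2_ge0 andbT eq_sym; apply: contraNneq v0 => N20.
      apply/eqP/rowP => i; rewrite [RHS]mxE; have [->//|si] := eqVneq i s.
      have [iN|iN] := boolP (i \in N); last by apply: vU; rewrite in_setU1 negb_or si.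
      apply/eqP; rewrite -sqrf_eq0; apply/eqP.
      by apply: (psumr_eq0P _ N20) => // l _; exact: sqr_ge0.
    move: (\sum_(i in N) _) (\sum_i _) (v 0 s) vsN N2_ge0 => N2 beta si vsN N20.
    move: uu.@[_] (P s s).@[_] => u a h1 h2 h3 h4 h5.
    have a0' : 0 < a by exact: lt_le_trans h5.
    rewrite -(pmulr_rgt0 _ a0').
    (* Multiplication by a completes the square. The deficit rho beta^2 is at most rho Mb N2, which
       for N2 > 0 is below p eps N2 <= a eps N2. *)
    have -> : a * (a * si ^+ 2 + 2 * 1 * si * beta + u * beta ^+ 2 + eps * N2) =
      (a * si + beta) ^+ 2 - rho * beta ^+ 2 + a * eps * N2.
      have -> : rho = 1 - u * a by rewrite h2 subKr.
      by ring.
    have h6 : rho * beta ^+ 2 <= rho * Mb * N2 by rewrite -mulrA ler_wpM2l.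
    have [N2pos|N2z] := ltP 0 N2.
      have h7 : rho * Mb * N2 < p * eps * N2 by rewrite ltr_pM2r.
      have h8 : p * eps * N2 <= a * eps * N2 by rewrite !ler_wpM2r // ltW.
      have := sqr_ge0 (a * si + beta).
      by lra.
    have N2E : N2 = 0 by apply/eqP; rewrite eq_le N2z.
    have betaE : beta = 0.
      apply/eqP; rewrite -sqrf_eq0 eq_le sqr_ge0 andbT.
      by apply: le_trans h1 _; rewrite N2E mulr0.
    case: vsN => [si0|]; last by rewrite N2E ltxx.
    by rewrite N2E betaE expr0n !mulr0 !addr0 subr0 exprn_even_gt0 //= mulf_neq0 // gt_eqF.
  + apply: contraNT; rewrite negb_and => ijA; rewrite !mxE.
    case/orP: ijA; rewrite in_setU1 negb_or => /andP[/negPf ks kN]; rewrite (bN _ kN) ks.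
      by rewrite (negPf kN) andbF /= !(mul0r, mulr0, addr0).
    case: (i =P j) => [->|_]; first by rewrite (negPf kN) !(mul0r, mulr0, addr0).
    by rewrite !(mul0r, mulr0, addr0).
split=> // [||i j].
- by rewrite /P' linearB linearZ /= P_sym /Q pivot_mx_sym.
- apply: (posdef_on_sphere P'_homog) => x xK x1 v v0 vU.
  have vs : v 0 s = 0 by apply: vU; rewrite !inE eqxx.
  rewrite eval_mxB qformB eval_mxZ qformZ rmorphXn /= sqnorm_eval x1 expr1n mul1r.
  rewrite (Q_eval _ x1) qform_pivot vs.
  have := a_ge x xK x1; have [rho []] := u_bound x xK x1.
  have betaE : \sum_i (b i).@[x 0] * v 0 i = \sum_i (eval_mx P x) i s * v 0 i.
    apply: eq_bigr => i _; rewrite mxE /b; case: eqP => // ->.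
    by rewrite vs !mulr0.
  have ev_sym : (eval_mx P x)^T = eval_mx P x.
    by apply/matrixP => i j; rewrite !mxE -{1}P_sym mxE.
  have vU' c : supported U (v + c *: delta_mx 0 s).
    move=> i iU; rewrite !mxE vU ?inE ?(negPf iU) ?andbF // eqxx.
    by case: eqP => [is_|]; rewrite ?mulr0 ?addr0 //; rewrite is_ sU in iU.
  have sqn_shift c : sqn v <= sqn (v + c *: delta_mx 0 s).
    apply: ler_sum => i _; rewrite !mxE eqxx; case: eqP => [->|_].
      by rewrite vs expr0n sqr_ge0.
    by rewrite mulr0 addr0.
  have N2_le : \sum_(i in N) v 0 i ^+ 2 <= sqn v.
    rewrite big_mkcond; apply: ler_sum => i _; case: ifP => // _; exact: sqr_ge0.
  have key c := pP x xK x1 _ (vU' c).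
  move: key; rewrite betaE => key h1 h2 h3 h4.
  (* The value - beta / a of the coordinate s minimises the form of P when the others are fixed; the
     minimum qP - beta^2 / a is thus at least p |v|^2, of which only eps = p / 2 is given to the
     clique block. *)
  have := key (- (\sum_i eval_mx P x i s * v 0 i) / (P s s).@[x 0]).
  rewrite qform_shift // [eval_mx P x s s]mxE.
  have := sqn_shift (- (\sum_i eval_mx P x i s * v 0 i) / (P s s).@[x 0]).
  have := sqn_gt0 v; rewrite v0.
  move: N2_le h1 h2 h4; set beta := \sum_i _ * v 0 i; set a := (P s s).@[_].
  move: (sqn (_ + _)) (sqn v) (\sum_(i in N) _) (qform _ _) uu.@[_] => S' S N2 qP u.
  move=> N2S ua rho_ge ap S_gt SS' qS.
  have a_gt : 0 < a by exact: lt_le_trans ap.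
  have uE : u = (1 - rho) / a by rewrite -ua mulfK // gt_eqF.
  have b2 : 0 <= rho * (beta ^+ 2 / a).
    by apply: mulr_ge0 => //; apply: divr_ge0; [exact: sqr_ge0 | exact: ltW].
  have qE : qP + 2 * (- beta / a) * beta + (- beta / a) ^+ 2 * a = qP - beta ^+ 2 / a.
    by field; rewrite gt_eqF.
  rewrite qE in qS.
  have pS : p * S <= p * S' by rewrite ler_pM2l.
  have eN : eps * N2 <= eps * S by rewrite ler_pM2l.
  have eS : eps * S = p * S / 2 by rewrite /eps; ring.
  have pS0 : 0 < p * S by rewrite mulr_gt0.
  have -> : a * 0 ^+ 2 + 2 * 1 * 0 * beta + u * beta ^+ 2 + eps * N2 =
    beta ^+ 2 / a - rho * (beta ^+ 2 / a) + eps * N2 by rewrite uE; ring.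
  by lra.
(* Row and column s of P' vanish identically, because Q repeats those of |x|^(2 a0) P. New nonzero
   entries come only from b b^T and I_N, hence lie in N x N. *)
- rewrite !mxE => Pij.
  have is_ : i != s.
    apply: contraNneq Pij => ->; rewrite eqxx /b eqxx !inE eqxx /= andbF.
    have -> : P s j = P j s by rewrite -{1}P_sym mxE.
    have [->|_] := eqVneq j s; first by rewrite !mulr1 !(mul0r, mulr0, addr0) subrr.
    by rewrite !(mul0r, mulr0, addr0, add0r, mul1r) subrr.
  have js : j != s.
    apply: contraNneq Pij => ->; rewrite eqxx /b eqxx (negPf is_) /=.
    by rewrite !(mul0r, mulr0, addr0, add0r, mulr1) subrr.
  split=> //; have [PE|] := eqVneq (P i j) 0; [right | by left].
  apply: contraNT Pij; rewrite negb_and PE (negPf is_) (negPf js) => ijN.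
  have bb : b i * b j = 0 by case/orP: ijN => /bN ->; rewrite ?mul0r ?mulr0.
  have -> : (i == j) && (i \in N) = false.
    by case: eqP ijN => //= <-; rewrite orbb => /negPf.
  by rewrite bb !(mul0r, mulr0, addr0) subrr.
Qed.

End Elimination.

(** * Chordal decomposition *)

Section ChordalDecomposition.
Variables (R : realType) (n q : nat) (g : 'I_q -> {mpoly R[n]}) (e : 'I_q -> nat).
Hypotheses (n_gt0 : (0 < n)%N) (g_homog : forall j, g j \is (e j + e j).-homog).
Variables (m t : nat) (C : 'I_t -> {set 'I_m}).
Local Notation sq := (sqnorm_mpoly R n).

(** Compression to A turns definiteness on vectors supported on A into definiteness of a matrix of
    size |A|, to which [matrix_putinar] applies. *)
Lemma clique_block_sos D (A : {set 'I_m}) k (Q : 'M[{mpoly R[n]}]_m) :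
  A \subset C k -> Q^T = Q -> homog_mx (D + D) Q -> posdef_on g A Q ->
  (forall i j, Q i j != 0 -> (i \in A) && (j \in A)) ->
  exists nu0, forall nu, (nu0 <= nu)%N ->
    clique_sos g e C (D + D + (nu + nu)) (sq ^+ nu *: Q).
Proof.
move=> AC Q_sym Q_homog Q_pos QA.
pose B : 'M[{mpoly R[n]}]_#|A| := \matrix_(i, j) Q (enum_val i) (enum_val j).
have [||x xK x0|nu0 nu0P] := @matrix_putinar R n q g e g_homog _ D B n_gt0.
- by apply/matrixP => i j; rewrite !mxE -{1}Q_sym mxE.
- by move=> i j; rewrite mxE.
- apply/posdef_qform => w w0.
  have -> : eval_mx B x = clique_mx R A *m eval_mx Q x *m (clique_mx R A)^T.
    by rewrite clique_mx_sub; apply/matrixP => i j; rewrite !mxE.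
  have := Q_pos x xK x0 (w *m clique_mx R A).
  rewrite /qform trmx_mul !mulmxA; apply => [|i iA].
    apply: contraNneq w0 => wE.
    by rewrite -[w]mulmx1 -(clique_mx_mul_tr R A) mulmxA wE mul0mx.
  rewrite mxE big1 // => l _; rewrite mxE; case: eqP => [li|_]; last by rewrite mulr0.
  by rewrite -li enum_valP in iA.
exists nu0 => nu /nu0P; rewrite (clique_mx_expand QA) clique_mx_sub -/B => BS.
have := clique_sos_single AC BS.
by rewrite -scalemxAr -scalemxAl.
Qed.

Variable (ed : rel 'I_m).
Hypotheses (ed_sym : ssrbool.symmetric ed) (ed_irr : irreflexive ed).
Hypothesis (ed_chordal : chordal ed).
Hypothesis (C_cover : forall A, clique ed A -> exists k, A \subset C k).

(** The graph [ed] stays fixed while P changes: a remainder may gain entries within the clique of s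
    and lose others by cancellation, so chordality of its own sparsity graph is not under control,
    but its entries stay on edges of [ed]. *)
Lemma chordal_posdef_sos D (U : {set 'I_m}) (P : 'M[{mpoly R[n]}]_m) :
  P^T = P -> homog_mx (D + D) P -> posdef_on g U P ->
  (forall i j, P i j != 0 -> [&& i \in U, j \in U & (i == j) || ed i j]) ->
  exists nu0, forall nu, (nu0 <= nu)%N ->
    clique_sos g e C (D + D + (nu + nu)) (sq ^+ nu *: P).
Proof.
have [k] := ubnP #|U|; elim: k U D P => // k IH U D P /ltnSE leU P_sym P_homog P_pos PU.
have [U0|Un0] := eqVneq U finset.set0.
  have -> : P = 0.
    apply/matrixP => i j; rewrite mxE; apply/eqP; apply: contraT => /PU.
    by rewrite U0 inE.
  by exists 0%N => nu _; rewrite scaler0; exact: clique_sos0.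
have [s sU s_simp] := chordal_simplicial ed_sym ed_irr ed_chordal Un0.
have [a0 [Q [P' [PE [Q_sym Q_homog Q_pos QA] [P'_sym P'_homog P'_pos P'U]]]]] :=
  pivot_split g_homog P_sym P_homog sU P_pos.
set N := finset _ in Q_pos QA P'U.
have N_nbh : s |: N \subset closed_nbh ed U s.
  apply/fintype.subsetP => i; rewrite !in_setU1 !inE; case: eqP => //= /eqP is_.
  by move=> /PU /and3P[-> _]; rewrite (negPf is_) ed_sym.
have N_clique : clique ed (s |: N).
  apply/cliqueP => i j /(fintype.subsetP N_nbh) iN /(fintype.subsetP N_nbh) jN.
  exact: (cliqueP _ _ s_simp).
have NU i : i \in s |: N -> i \in U.
  move/(fintype.subsetP N_nbh); rewrite in_setU1 inE => /predU1P[->//|/andP[]//].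
have [kc AC] := C_cover N_clique.
have [nu1 nu1P] := clique_block_sos AC Q_sym Q_homog Q_pos QA.
have [||nu2 nu2P] := IH (U :\ s) _ P' _ P'_sym P'_homog P'_pos.
- by apply: leq_trans leU; rewrite [X in (_ < X)%N](cardsD1 s) sU.
- move=> i j /P'U[is_ js [/PU|/andP[iN jN]]].
    by rewrite !in_setD1 is_ js.
  rewrite !in_setD1 is_ js !NU ?in_setU1 ?iN ?jN ?orbT //=.
  have [//|ij] := eqVneq i j.
  by apply: (cliqueP _ _ N_clique); rewrite // in_setU1 ?iN ?jN orbT.
(* The split consumes [a0]; what is left of the exponent is large enough for both the clique block
   and the remainder. *)
exists (a0 + (nu1 + nu2))%N => nu le_nu.
have [nu' -> [le1 le2]] : exists2 nu', nu = (nu' + a0)%N & (nu1 <= nu')%N /\ (nu2 <= nu')%N.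
  by exists (nu - a0)%N; lia.
rewrite exprD -scalerA PE scalerDr.
have -> : (D + D + (nu' + a0 + (nu' + a0)) = D + a0 + (D + a0) + (nu' + nu'))%N by lia.
by apply: clique_sosD; [exact: nu1P | exact: nu2P].
Qed.

End ChordalDecomposition.

Theorem theorem2p5 (R : realType) (n q m t : nat)
  (g : 'I_q -> {mpoly R[n]})
  (g_homog : forall j : 'I_q, exists d : nat, ~~ odd d /\ g j \is d.-homog)
  (K_nontriv : exists x : 'rV[R]_n, basic_semialg g x /\ x != 0)
  (P : 'M[{mpoly R[n]}]_m)
  (P_sym : P^T = P)
  (P_homog : exists d : nat, ~~ odd d /\ homog_mx d P)
  (P_chordal : chordal (sparsity_graph P))
  (C : 'I_t -> {set 'I_m})
  (C_inj : injective C)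
  (C_max : forall A : {set 'I_m},
     maximal_clique (sparsity_graph P) A <-> exists k : 'I_t, C k = A)
  (P_pos : forall x : 'rV[R]_n, basic_semialg g x -> x != 0 ->
     posdef (eval_mx P x)) :
  exists (nu : nat)
    (S : forall (j : 'I_q.+1) (k : 'I_t), 'M[{mpoly R[n]}]_#|C k|),
    (forall j k, (exists d : nat, homog_mx d (S j k)) /\ sos_mx (S j k)) /\
    sqnorm_mpoly R n ^+ nu *: P =
      \sum_(k < t)
        (clique_mx {mpoly R[n]} (C k))^T *m
        (S ord0 k + \sum_(j < q) g j *: S (lift ord0 j) k) *m
        clique_mx {mpoly R[n]} (C k).
Proof.
(* A nonzero point rules out n = 0, where |x|^2 is the zero polynomial. *)
have [x [_ x0]] := K_nontriv.
have n_gt0 : (0 < n)%N.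
  by case: (n) x x0 => // x; rewrite (thinmx0 x) eqxx.
have [e g_homog'] : exists e : 'I_q -> nat, forall j, g j \is (e j + e j).-homog.
  suff H j : exists ej, g j \is (ej + ej).-homog by have [f fP] := choice H; exists f.
  by have [d [d_even gd]] := g_homog j; exists d./2; rewrite addnn even_halfK.
have [D P_homog'] : exists D, homog_mx (D + D) P.
  by have [d [d_even Pd]] := P_homog; exists d./2; rewrite addnn even_halfK.
have ed_sym : ssrbool.symmetric (sparsity_graph P).
  by move=> i j; rewrite /sparsity_graph /= eq_sym -{1}P_sym mxE.
have ed_irr : irreflexive (sparsity_graph P) by move=> i; rewrite /sparsity_graph /= eqxx.
have C_cover A : clique (sparsity_graph P) A -> exists k, A \subset C k.
  move=> /(@maxset_exists _ (clique (sparsity_graph P)))[B Bmax AB].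
  by have [k kB] := (C_max B).1 Bmax; exists k; rewrite kB.
have [||nu nuP] := chordal_posdef_sos n_gt0 g_homog' ed_sym ed_irr P_chordal C_cover
  (U := [set: 'I_m]%SET) P_sym P_homog'.
- by move=> y yK y0 v v0 _; have /posdef_qform := P_pos y yK y0; exact.
- by move=> i j Pij; rewrite !inE /sparsity_graph /= Pij andbT orbN.
have [S [S_sos SE]] := nuP nu (leqnn nu).
exists nu, (fun j k => projT1 (cid (S_sos k)) j); split=> [j k|].
  case: (cid (S_sos k)) => T /= [T_sos T0 T1 _]; split=> //.
  have [j' ->|->] := unliftP ord0 j; [by eexists; exact: T1 | by eexists; exact: T0].
rewrite SE; apply: eq_bigr => k _; congr (_ *m _ *m _).
by case: (cid (S_sos k)) => T /= [_ _ _ ->].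
Qed.
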